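(* Let $B\subset\mathbb{R}^4$ be an open set, let $f=(f^4,f^5,f^6,f^7):B\to T^4$ be a smooth map, let $X=B\times T^4$ carry the flat metric and the standard $\mathrm{Spin}(7)$-structure $\Phi$, and let $S=\{(x,f(x))\mid x\in B\}\subset X$ be the graph of $f$. Let $\nabla^S$ be the real Fourier--Mukai transform of $S$, a Hermitian connection of the trivial complex line bundle over $B\times(T^4)^*\cong X$, with curvature $F^S_\nabla\in\sqrt{-1}\,\Omega^2(X)$. Then $S$ is a Cayley submanifold of $X$ for an appropriate orientation of $S$ if and only if $$\pi^2_7\Big(F^S_\nabla+\tfrac16 *(F^S_\nabla)^3\Big)=0\quad\text{and}\quad \pi^4_7\big((F^S_\nabla)^2\big)=0 .$$
   Context: Notation: $e^{i_1\cdots i_k}=e^{i_1}\wedge\cdots\wedge e^{i_k}$; powers of forms are wedge powers; $i(\cdot)$ is the interior product; $\alpha^\sharp$ is the metric dual of a 1-form $\alpha$. Setting: $T^4=\mathbb{R}^4/(2\pi\mathbb{Z})^4$. Coordinates on $B$ are $(x^0,x^1,x^2,x^3)$ and on $T^4$ are $(y^4,y^5,y^6,y^7)$. $X=B\times T^4$ has the flat product metric $\sum (dx^i)^2+\sum (dy^a)^2$. Set $(e^0,\dots,e^7)=(dx^0,\dots,dx^3,dy^4,\dots,dy^7)$, a positively oriented orthonormal coframe; $*$ is the Hodge star. Put $\varphi=e^{123}+e^{145}+e^{167}+e^{246}-e^{257}-e^{347}-e^{356}$ and $*_7\varphi=e^{4567}+e^{2367}+e^{2345}+e^{1357}-e^{1346}-e^{1256}-e^{1247}$.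 The standard $\mathrm{Spin}(7)$-structure is $\Phi=e^0\wedge\varphi+*_7\varphi$. Cayley: an oriented 4-dimensional submanifold is Cayley if it is calibrated by $\Phi$, i.e. the restriction of $\Phi$ to it equals its induced Riemannian volume form. Projections: $\pi^k_\ell:\Omega^k\to\Omega^k_\ell$ is the orthogonal projection (extended complex linearly) onto the forms with values in the subbundle of $\Lambda^kT^*X$ corresponding to the $\ell$-dimensional irreducible $\mathrm{Spin}(7)$-representation, where $\Lambda^2\cong W_7\oplus W_{21}$ and $\Lambda^4\cong W_1\oplus W_7\oplus W_{27}\oplus W_{35}$. Explicitly, pointwise, $\Lambda^2_7=\{\alpha\mid \Phi\wedge\alpha=3*\alpha\}$ (so $\pi^2_7(\alpha)=\frac14(\alpha+*(\Phi\wedge\alpha))$) and $\Lambda^4_7=\{e^0\wedge i(\alpha^\sharp)*_7\varphi-\alpha\wedge\varphi\mid \alpha\in\mathrm{span}(e^1,\dots,e^7)\}$. Real Fourier--Mukai transform: $B\times(T^4)^*$ is identified with $X=B\times T^4$, and $\nabla^S=d+\sqrt{-1}\sum_{a=4}^7 f^a\,dy^a$ on the trivial complex line bundle. Its curvature is $F^S_\nabla=\sqrt{-1}\sum_{i=0}^3\sum_{a=4}^7\frac{\partial f^a}{\partial x^i}\,dx^i\wedge dy^a$. (The components $f^a$ are defined modulo $2\pi$, so $\partial f^a/\partial x^i$ are well-defined functions on $B$.) *)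

(* Defs.v *)
From HB Require Import structures.
From mathcomp Require Import all_boot all_order all_algebra.
From mathcomp Require Import generic_quotient complex.
From mathcomp Require Import all_classical all_reals all_analysis.

Set Implicit Arguments.
Unset Strict Implicit.
Unset Printing Implicit Defensive.

Import Order.TTheory GRing.Theory Num.Theory.
Import numFieldNormedType.Exports.

Local Open Scope classical_set_scope.
Local Open Scope ring_scope.

(* Elements of the exterior algebra of (R^8)^*, possibly complexified.
   The coordinate of [alpha : form K] on the set of indices
   A = {i_1 < ... < i_k} is its coefficient on e^{i_1} /\ ... /\ e^{i_k}. *)
Notation form K := {ffun {set 'I_8} -> K}.

(* e^A /\ e^B = shuffle_sign A B * e^{A u B} for disjoint A and B. *)
Definition shuffle_sign (K : nzRingType) (A B : {set 'I_8}) : K :=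
  (-1) ^+ #|[set p : 'I_8 * 'I_8 |
              [&& p.1 \in A, p.2 \in B & (p.2 < p.1)%N]]%SET|.

Definition homogeneous (K : nzRingType) (k : nat) (alpha : form K) : Prop :=
  forall A, alpha A != 0 -> #|A| = k.

Definition form1 (K : nzRingType) : form K := [ffun A => (A == finset.set0)%:R].

Definition covec (K : nzRingType) (i : 'I_8) : form K :=
  [ffun A => (A == [set i]%SET)%:R].

Definition wedge (K : nzRingType) (alpha beta : form K) : form K :=
  [ffun C : {set 'I_8} => \sum_(A : {set 'I_8} | A \subset C)
    shuffle_sign K A (C :\: A) * alpha A * beta (C :\: A)].

Definition wedge_exp (K : nzRingType) (alpha : form K) (n : nat) : form K :=
  iter n (wedge alpha) (form1 K).

(* [mono K [:: i1; ...; ik]] is e^{i1...ik}. *)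
Definition mono (K : nzRingType) (s : seq nat) : form K :=
  foldr (fun i => wedge (covec K (inord i))) (form1 K) s.

(* Hodge star of the flat metric: *e^A is the e^{~A}-multiple such that
   e^A /\ *e^A = e^{01234567}. *)
Definition hodge (K : nzRingType) (alpha : form K) : form K :=
  [ffun A : {set 'I_8} => shuffle_sign K (~: A) A * alpha (~: A)].

Definition interior_prod (K : nzRingType) (v : 'rV[K]_8) (alpha : form K) :
    form K :=
  [ffun A : {set 'I_8} => \sum_(j | j \notin A)
    v 0 j * shuffle_sign K [set j]%SET A * alpha (j |: A)%SET].

Definition inner (K : nzRingType) (alpha beta : form K) : K :=
  \sum_(A : {set 'I_8}) alpha A * beta A.

(* alpha(w_1, ..., w_k), where w_1, ..., w_k are the rows of W. *)
Definition form_eval (K : comNzRingType) (k : nat) (alpha : form K)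
    (W : 'M[K]_(k, 8)) : K :=
  \sum_(A : {set 'I_8} | #|A| == k)
    alpha A * \det (\matrix_(i < k, j < k) W i (nth ord0 (enum A) j)).

Definition phi (K : nzRingType) : form K :=
  mono K [:: 1; 2; 3]%N + mono K [:: 1; 4; 5]%N + mono K [:: 1; 6; 7]%N
  + mono K [:: 2; 4; 6]%N - mono K [:: 2; 5; 7]%N
  - mono K [:: 3; 4; 7]%N - mono K [:: 3; 5; 6]%N.

Definition star7_phi (K : nzRingType) : form K :=
  mono K [:: 4; 5; 6; 7]%N + mono K [:: 2; 3; 6; 7]%N
  + mono K [:: 2; 3; 4; 5]%N + mono K [:: 1; 3; 5; 7]%N
  - mono K [:: 1; 3; 4; 6]%N - mono K [:: 1; 2; 5; 6]%N
  - mono K [:: 1; 2; 4; 7]%N.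

Definition Phi (K : nzRingType) : form K :=
  wedge (covec K 0) (phi K) + star7_phi K.

(* [Lambda27] and [Lambda47] are the fibres of the subbundles of Lambda^2 and
   Lambda^4 given by the 7-dimensional irreducible Spin(7)-representation. *)
Definition Lambda27 (R : realType) : set (form R) :=
  [set alpha | homogeneous 2 alpha /\
               wedge (Phi R) alpha = 3%:R *: hodge alpha].

Definition sharp (R : realType) (alpha : form R) : 'rV[R]_8 :=
  \row_j alpha [set j]%SET.

Definition Lambda47 (R : realType) : set (form R) :=
  [set beta | exists c : 'I_8 -> R, c 0 = 0 /\
     let alpha := \sum_(j < 8) c j *: covec R j in
     beta = wedge (covec R 0) (interior_prod (sharp alpha) (star7_phi R))
            - wedge alpha (phi R)].

Definition orth_proj (R : realType) (U : set (form R)) (alpha : form R) :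
    form R :=
  xget 0 [set beta | U beta /\ forall gamma, U gamma ->
                       inner (alpha - beta) gamma = 0].

Definition cform (R : realType) (alpha : form R) : form R[i] :=
  [ffun A => (alpha A)%:C%C].

(* Complex linear extension of the real linear map p. *)
Definition complexify (R : realType) (p : form R -> form R)
    (alpha : form R[i]) : form R[i] :=
  cform (p [ffun A => complex.Re (alpha A)])
  + 'i%C *: cform (p [ffun A => complex.Im (alpha A)]).

Definition pi27 (R : realType) : form R[i] -> form R[i] :=
  complexify (orth_proj (@Lambda27 R)).

Definition pi47 (R : realType) : form R[i] -> form R[i] :=
  complexify (orth_proj (@Lambda47 R)).

(* f is of class C^k on the open set U. *)
Fixpoint Ck (R : realType) (V W : normedModType R) (k : nat) (U : set V)
    (f : V -> W) : Prop :=
  if k is k'.+1 then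
    (forall x, U x -> differentiable f x) /\
    (forall v : V, Ck k' U (fun x => 'D_v f x))
  else forall x, U x -> {for x, continuous f}.

Definition smooth_on (R : realType) (V W : normedModType R) (U : set V)
    (f : V -> W) : Prop := forall k, Ck k U f.

Definition lattice_rel (R : realType) (x y : 'rV[R]_4) : bool :=
  `[< exists k : 'rV[int]_4, y - x = (2 * pi) *: map_mx intr k >].

Lemma lattice_rel_refl (R : realType) : reflexive (@lattice_rel R).
Proof.
move=> x; apply/asboolP; exists 0.
by rewrite subrr map_mx0 scaler0.
Qed.

Lemma lattice_rel_sym (R : realType) : symmetric (@lattice_rel R).
Proof.
have H (x y : 'rV[R]_4) : lattice_rel x y -> lattice_rel y x.
  move=> /asboolP[k xy]; apply/asboolP; exists (- k).
  by rewrite map_mxN scalerN -xy opprB.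
by move=> x y; apply/idP/idP; apply: H.
Qed.

Lemma lattice_rel_trans (R : realType) : transitive (@lattice_rel R).
Proof.
move=> y x z /asboolP[k xy] /asboolP[l yz]; apply/asboolP; exists (l + k).
by rewrite map_mxD scalerDr -xy -yz addrA subrK.
Qed.

Canonical lattice_equiv (R : realType) :=
  EquivRel (@lattice_rel R) (@lattice_rel_refl R) (@lattice_rel_sym R)
    (@lattice_rel_trans R).

Definition torus (R : realType) : Type :=
  {eq_quot (lattice_equiv R)}%qT.

Definition torus_pi (R : realType) (y : 'rV[R]_4) : torus R :=
  (\pi_({eq_quot (lattice_equiv R)}) y)%qT.

(* [g] is a smooth lift of [f] to R^4 on a neighbourhood of [x]. *)
Definition local_lift (R : realType) (f : 'rV[R]_4 -> torus R) (x : 'rV[R]_4)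
    (g : 'rV[R]_4 -> 'rV[R]_4) : Prop :=
  exists U : set 'rV[R]_4, [/\ open U, U x, smooth_on U g &
    forall z, U z -> torus_pi (g z) = f z].

Definition smooth_to_torus (R : realType) (B : set 'rV[R]_4)
    (f : 'rV[R]_4 -> torus R) : Prop :=
  forall x, B x -> exists g, local_lift f x g.

(* Two local lifts at [x] differ by a constant near [x], so the germ at [x]
   of the derivatives of [lift_at f x] does not depend on the choice. *)
Definition lift_at (R : realType) (f : 'rV[R]_4 -> torus R) (x : 'rV[R]_4) :
    'rV[R]_4 -> 'rV[R]_4 :=
  xget (cst 0) [set g | local_lift f x g].

(* The tangent spaces of R^4 x T^4 are identified with R^8 through the
   local isometry [covering]; forms on B x T^4 are given by functions of a
   point of R^8 lying over B x T^4. *)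
Definition ambient (R : realType) : Type := ('rV[R]_4 * torus R)%type.

Definition base (R : realType) (q : 'rV[R]_8) : 'rV[R]_4 :=
  lsubmx (q : 'rV[R]_(4 + 4)).

Definition fibre (R : realType) (q : 'rV[R]_8) : 'rV[R]_4 :=
  rsubmx (q : 'rV[R]_(4 + 4)).

Definition covering (R : realType) (q : 'rV[R]_8) : ambient R :=
  (base q, torus_pi (fibre q)).

Definition torus_graph (R : realType) (B : set 'rV[R]_4)
    (f : 'rV[R]_4 -> torus R) : set (ambient R) :=
  [set (x, f x) | x in B].

(* Embedded 4-dimensional submanifold: locally a regular level set. *)
Definition submanifold4 (R : realType) (S : set (ambient R)) : Prop :=
  forall q : 'rV[R]_8, S (covering q) ->
  exists (V : set 'rV[R]_8) (h : 'rV[R]_8 -> 'rV[R]_4),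
    [/\ open V, V q, smooth_on V h,
        forall q', V q' -> \rank (jacobian h q') = 4%N &
        forall q', V q' -> (S (covering q') <-> h q' = 0)].

(* Velocities at p of smooth curves in S through p. *)
Definition tangent (R : realType) (S : set (ambient R)) (p : ambient R)
    (v : 'rV[R]_8) : Prop :=
  exists (I : set R^o) (c : R^o -> 'rV[R]_8),
    [/\ open I, I 0, smooth_on I c &
        [/\ covering (c 0) = p, forall t, I t -> S (covering (c t)) &
            'D_1 c 0 = v]].

(* The rows of E form a basis of T_p S. *)
Definition tangent_basis (R : realType) (S : set (ambient R)) (p : ambient R)
    (E : 'M[R]_(4, 8)) : Prop :=
  row_free E /\ forall v : 'rV[R]_8, tangent S p v <-> (v <= E)%MS.

(* [o p] is the set of positively oriented bases of T_p S: a class of bases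
   modulo changes of basis of positive determinant, depending continuously
   on p. *)
Definition orientation (R : realType) (S : set (ambient R))
    (o : ambient R -> set 'M[R]_(4, 8)) : Prop :=
  forall q : 'rV[R]_8, S (covering q) ->
  exists (V : set 'rV[R]_8) (E : 'rV[R]_8 -> 'M[R]_(4, 8)),
    [/\ open V, V q, {within V `&` (@covering R @^-1` S), continuous E} &
        forall q', V q' -> S (covering q') ->
          tangent_basis S (covering q') (E q') /\
          o (covering q') =
            [set A *m E q' | A in [set A : 'M[R]_4 | 0 < \det A]]].

Definition orthonormal_frame (R : realType) (E : 'M[R]_(4, 8)) : Prop :=
  E *m E^T = 1%:M.

(* The induced volume form takes the value [\det (W *m E^T)] on tangent vectors
   given by the rows of W, if E is an oriented orthonormal basis. *)
Definition cayley (R : realType) (S : set (ambient R))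
    (o : ambient R -> set 'M[R]_(4, 8)) : Prop :=
  [/\ submanifold4 S, orientation S o &
      forall p, S p -> forall E, o p E -> orthonormal_frame E ->
      forall W : 'M[R]_(4, 8), (forall i, tangent S p (row i W)) ->
        form_eval (Phi R) W = \det (W *m E^T)].

Definition ext_d (R : realType) (a : 'rV[R]_8 -> form R) (q : 'rV[R]_8) :
    form R :=
  \sum_(i < 8) wedge (covec R i)
    [ffun A => 'D_(delta_mx 0 i) (fun q' => a q' A : R^o) q].

(* For a lift g of f, the connection is d + sqrt(-1) * FM_potential g. *)
Definition FM_potential (R : realType) (g : 'rV[R]_4 -> 'rV[R]_4)
    (q : 'rV[R]_8) : form R :=
  \sum_(a < 4) g (base q) 0 a *: covec R (rshift 4 a).

(* The curvature of d + sqrt(-1) * a on a complex line bundle is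
   sqrt(-1) * da; it does not depend on the lift. *)
Definition FM_curvature (R : realType) (f : 'rV[R]_4 -> torus R)
    (q : 'rV[R]_8) : form R[i] :=
  'i%C *: cform (ext_d (FM_potential (lift_at f (base q))) q).

(* Main.v *)
(** Let J be the Jacobian of f at a point, omega = sum J_ia e^i /\ e^(4+a), so
    that F = sqrt(-1) omega, and W = (1 | J), whose rows span the tangent space
    of the graph.  Up to constants, the components of
    omega - *omega^3/6 in Lambda^2_7 and of omega^2 in Lambda^4_7 are the values
    on W of the seven 4-forms tau_k of the Cayley equality
      Phi(W)^2 + sum_k tau_k(W)^2 = det (W W^T),
    a polynomial identity in the 16 entries of J: four of the tau_k(W) are odd
    in J, because the coefficients of *omega^3/6 are the cofactors of J, and
    three are even.  Hence the curvature equations say that Phi(W) is plus or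
    minus the volume of W.  As Phi(W) is then continuous and nonzero, it selects
    an orientation of the graph for which the sign is plus. *)

Require Import Defs.
From HB Require Import structures.
From mathcomp Require Import all_boot all_order all_algebra.
From mathcomp Require Import generic_quotient complex.
From mathcomp Require Import all_classical all_reals all_analysis.
From mathcomp Require Import ring lra zify.
(* Imported again because sesquilinear.v also defines [form]. *)
Require Import Defs.

Set Implicit Arguments.
Unset Strict Implicit.
Unset Printing Implicit Defensive.

Import Order.TTheory GRing.Theory Num.Theory.
Import numFieldNormedType.Exports.

Local Open Scope classical_set_scope.
Local Open Scope ring_scope.

(** * Multi-indices and basis forms *)

(** Forms are functions on the 256 subsets of ['I_8], and the operations on them do not evaluate to
    anything usable over an abstract field. Forms whose coefficients are polynomials in numbered
    variables are therefore encoded as lists of signed monomials; wedge, Hodge star, interior and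
    inner product become list programs, each proved correct once. The virtual machine evaluates the
    lists, and only scalar identities reach [ring], [field] or [lra]. The projections are defined by
    choice. Showing each subbundle to be the span of seven explicit orthogonal forms turns the
    vanishing of a projection into seven vanishing inner products. The torus enters through lifts to
    R^4. Two vectors with the same image in the torus coincide when they are closer than 2 pi, so
    near each of its points the graph is the zero set of a difference of lifts. The Jacobian of a
    lift can be recovered from the tangent space of the graph, which makes the choice of lift
    immaterial. *)

Definition idx (s : seq nat) : {set 'I_8} := [set i : 'I_8 | val i \in s]%SET.

Definition multi_index (s : seq nat) : bool := uniq s && all (gtn 8) s.

(** Only pairs across the two lists count: [idx] forgets the order, so the basis form of an unsorted
    list is the increasing monomial on the same indices. *)
Definition inversions (s t : seq nat) : nat :=
  count (fun p => (p.2 < p.1)%N) [seq (x, y) | x <- s, y <- t].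

Lemma mem_map_inord (s : seq nat) (i : 'I_8) : all (gtn 8) s ->
  (i \in [seq inord x : 'I_8 | x <- s]) = (val i \in s).
Proof.
move=> /allP s8; apply/mapP/idP => [[x xs ->]|iin].
  by rewrite /= inordK //; apply: s8.
by exists (val i) => //; rewrite inord_val.
Qed.

Lemma inord_inj_in (s : seq nat) : all (gtn 8) s ->
  {in s &, injective (fun x => inord x : 'I_8)}.
Proof.
move=> /allP s8 x y xs ys /(congr1 val); rewrite /= !inordK //; exact: s8.
Qed.

Lemma shuffle_sign_idx (K : nzRingType) (s t : seq nat) :
  multi_index s -> multi_index t ->
  shuffle_sign K (idx s) (idx t) = (-1) ^+ inversions s t.
Proof.
move=> /andP[us s8] /andP[ut t8]; rewrite /shuffle_sign; congr (_ ^+ _).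
pose f (n : nat) : 'I_8 := inord n.
pose L := [seq p : 'I_8 * 'I_8 <- [seq (x, y) | x <- map f s, y <- map f t]
              | (p.2 < p.1)%N].
have uL : uniq L.
  rewrite filter_uniq // allpairs_uniq //; last by move=> [? ?] [? ?].
    by rewrite map_inj_in_uniq //; apply: inord_inj_in.
  by rewrite map_inj_in_uniq //; apply: inord_inj_in.
rewrite (_ : #|_| = #|L|).
  rewrite (card_uniqP uL) size_filter /inversions.
  have -> : [seq (x, y) | x <- map f s, y <- map f t] =
      [seq (f p.1, f p.2) | p <- [seq (x, y) | x <- s, y <- t]].
    by rewrite map_allpairs allpairs_mapl allpairs_mapr.
  rewrite count_map.
  apply: eq_in_count => -[x y] /allpairsP[[u v] [/= us' vt [-> ->]]] /=.
  by rewrite !inordK //; [apply: (allP s8)|apply: (allP t8)].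
apply: eq_card => -[x y]; rewrite inE mem_filter /= [RHS]andbC andbA;
  congr (_ && _).
rewrite !inE -!mem_map_inord //; apply/andP/allpairsP => [[xs yt]|].
  by exists (x, y).
by move=> [[u v] [/= us' vt [-> ->]]].
Qed.

Lemma idx_inj (s t : seq nat) : multi_index s -> multi_index t ->
  (idx s == idx t) = perm_eq s t.
Proof.
move=> /andP[us /allP s8] /andP[ut /allP t8];
  apply/eqP/idP => [st|/perm_mem st].
  rewrite uniq_perm // => x; apply/idP/idP => xin.
    by have := s8 _ xin => x8; have /setP/(_ (Ordinal x8)) := st;
      rewrite !inE /= xin.
  by have := t8 _ xin => x8; have /setP/(_ (Ordinal x8)) := st;
    rewrite !inE /= xin.
by apply/setP => i; rewrite !inE st.
Qed.

Definition basis_form (K : nzRingType) (S : {set 'I_8}) : form K :=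
  [ffun A => (A == S)%:R].

Lemma wedgeDl (K : nzRingType) (a b c : form K) :
  wedge (a + b) c = wedge a c + wedge b c.
Proof.
apply/ffunP => A; rewrite !ffunE -big_split; apply: eq_bigr => B _ /=.
by rewrite ffunE mulrDr mulrDl.
Qed.

Lemma wedgeDr (K : nzRingType) (a b c : form K) :
  wedge a (b + c) = wedge a b + wedge a c.
Proof.
apply/ffunP => A; rewrite !ffunE -big_split; apply: eq_bigr => B _ /=.
by rewrite ffunE mulrDr.
Qed.

Lemma wedgeZl (K : numFieldType) (k : K) (a b : form K) :
  wedge (k *: a) b = k *: wedge a b.
Proof.
apply/ffunP => A; rewrite !ffunE scaler_sumr; apply: eq_bigr => B _ /=.
by rewrite ffunE /GRing.scale /=; ring.
Qed.

Lemma wedgeZr (K : numFieldType) (k : K) (a b : form K) :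
  wedge a (k *: b) = k *: wedge a b.
Proof.
apply/ffunP => A; rewrite !ffunE scaler_sumr; apply: eq_bigr => B _ /=.
by rewrite ffunE /GRing.scale /=; ring.
Qed.

Lemma wedge0l (K : nzRingType) (a : form K) : wedge 0 a = 0.
Proof.
by apply/ffunP => A; rewrite !ffunE big1 // => B _; rewrite ffunE mulr0 mul0r.
Qed.

Lemma wedge0r (K : nzRingType) (a : form K) : wedge a 0 = 0.
Proof.
by apply/ffunP => A; rewrite !ffunE big1 // => B _; rewrite ffunE mulr0.
Qed.

Lemma wedge_suml (K : nzRingType) (I : Type) (r : seq I) (F : I -> form K) b :
  wedge (\sum_(i <- r) F i) b = \sum_(i <- r) wedge (F i) b.
Proof.
elim/big_ind2 : _ => [|? ? ? ? <- <-|//]; first exact: wedge0l.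
exact: wedgeDl.
Qed.

Lemma wedge_sumr (K : nzRingType) (I : Type) (r : seq I) (F : I -> form K) a :
  wedge a (\sum_(i <- r) F i) = \sum_(i <- r) wedge a (F i).
Proof.
elim/big_ind2 : _ => [|? ? ? ? <- <-|//]; first exact: wedge0r.
exact: wedgeDr.
Qed.

Lemma wedge_basis (K : numFieldType) (S T : {set 'I_8}) :
  wedge (basis_form K S) (basis_form K T) =
  if [disjoint S & T] then shuffle_sign K S T *: basis_form K (S :|: T)%SET
    else 0.
Proof.
apply/ffunP => C; rewrite ffunE.
transitivity (if (S \subset C) && (C :\: S == T)%SET then shuffle_sign K S T
  else 0).
  case: ifPn => [/andP[SC /eqP CS]|nSC].
    rewrite (bigD1 S) //= !ffunE eqxx CS eqxx !mulr1 big1 ?addr0 // =>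
      A /andP[_ AS].
    by rewrite !ffunE (negbTE AS) mulr0 mul0r.
  rewrite big1 // => A AC; rewrite !ffunE.
  have [AS|_] := eqVneq A S; last by rewrite mulr0 mul0r.
  by move: nSC; rewrite -AS AC /= => /negbTE ->; rewrite mulr0.
have -> : (S \subset C) && (C :\: S == T)%SET =
    [disjoint S & T] && (C == S :|: T)%SET.
  apply/andP/andP => -[] => [SC /eqP <-|/pred0P dST /eqP ->].
    split; first by apply/pred0P => x; rewrite /= !inE; case: (x \in S).
    apply/eqP/setP => x; rewrite !inE; case: (boolP (x \in S)) => //= xS.
    by rewrite (fintype.subsetP SC).
  rewrite finset.subsetUl; split=> //; apply/eqP/setP => x.
  by have := dST x; rewrite /= !inE; case: (x \in S).
case: (disjoint _ _) => /=; last by rewrite ffunE.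
by rewrite !ffunE /GRing.scale /=; case: ifP; rewrite ?mulr1 ?mulr0.
Qed.

Lemma idx_cat (s t : seq nat) : idx (s ++ t) = (idx s :|: idx t)%SET.
Proof. by apply/setP => i; rewrite !inE mem_cat. Qed.

Lemma disjoint_idx (s t : seq nat) : multi_index s ->
  disjoint (mem (idx s)) (mem (idx t)) = ~~ has (mem s) t.
Proof.
move=> /andP[_ /allP s8].
apply/pred0P/hasPn => [st x xt|st i]; last first.
  by rewrite /= !inE; apply/negP => /andP[si /st] /=; rewrite si.
apply/negP => /= xs; have x8 := s8 _ xs.
by have := st (Ordinal x8); rewrite /= !inE /= xs xt.
Qed.

Lemma wedge_basis_idx (K : numFieldType) (s t : seq nat) :
  multi_index s -> multi_index t ->
  wedge (basis_form K (idx s)) (basis_form K (idx t)) =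
  if has (mem s) t then 0
  else (-1) ^+ inversions s t *: basis_form K (idx (s ++ t)).
Proof.
move=> ms mt; rewrite wedge_basis disjoint_idx // if_neg idx_cat.
by rewrite shuffle_sign_idx.
Qed.

Lemma hodge_basis_idx (K : numFieldType) (s : seq nat) :
  multi_index s ->
  let t := [seq x <- iota 0 8 | x \notin s] in
  hodge (basis_form K (idx s)) = (-1) ^+ inversions s t *: basis_form K (idx t).
Proof.
move=> ms t.
have st : ~: idx s = idx t.
  by apply/setP => i; rewrite !inE mem_filter mem_iota /= ltn_ord andbT.
have mt : multi_index t.
  rewrite /multi_index filter_uniq ?iota_uniq //=; apply/allP => x.
  by rewrite mem_filter mem_iota => /andP[_].
apply/ffunP => A; rewrite !ffunE -st.
have [->|As] := eqVneq A (~: idx s)%SET.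
  by rewrite finset.setCK eqxx st shuffle_sign_idx.
have -> : (~: A == idx s) = false.
  by apply: contraNF As => /eqP <-; rewrite finset.setCK.
by rewrite mulr0 scaler0.
Qed.

(** The sign counts the entries of [s] smaller than [x] rather than the position of [x], since [s]
    need not be sorted. *)
Lemma interior_basis_idx (K : numFieldType) (v : 'rV[K]_8) (s : seq nat) :
  multi_index s ->
  interior_prod v (basis_form K (idx s)) =
  \sum_(x <- s) v 0 (inord x) * (-1) ^+ inversions [:: x] (rem x s)
                 *: basis_form K (idx (rem x s)).
Proof.
move=> ms; have /andP[us /allP s8] := ms.
have idx_rem x : x \in s -> idx s = (inord x |: idx (rem x s))%SET.
  move=> xs; apply/setP => i; rewrite !inE mem_rem_uniq // inE.
  rewrite -val_eqE /= inordK; last exact: s8.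
  by have [->|] := eqVneq (val i) x.
apply/ffunP => A; rewrite ffunE sum_ffunE.
under eq_bigr do rewrite ffunE.
transitivity (\sum_(j | j \in idx s) if j \notin A then
    v 0 j * shuffle_sign K [set j]%SET A * (j |: A == idx s)%SET%:R else 0).
  rewrite [LHS]big_mkcond [RHS]big_mkcond; apply: eq_bigr => j _ /=.
  case: ifPn => // jA; case: ifPn => // js.
  have [jAs|_] := eqVneq (j |: A)%SET (idx s); last by rewrite mulr0.
  by rewrite -jAs setU11 in js.
have us' : uniq [seq inord x : 'I_8 | x <- s].
  by rewrite map_inj_in_uniq //; apply: inord_inj_in; apply/allP.
transitivity (\sum_(j <- [seq inord x : 'I_8 | x <- s]) if j \notin A then
    v 0 j * shuffle_sign K [set j]%SET A * (j |: A == idx s)%SET%:R else 0).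
  rewrite [RHS]big_uniq //; apply: eq_bigl => j.
  by rewrite mem_map_inord ?inE //; apply/allP.
rewrite big_map big_seq [RHS]big_seq; apply: eq_bigr => x xs.
rewrite !ffunE.
have xr : inord x \notin idx (rem x s).
  by rewrite inE mem_rem_uniq // inE /= inordK ?eqxx //; exact: s8.
have [->|Ar] := eqVneq A (idx (rem x s)).
  rewrite xr -idx_rem // !eqxx; congr (_ * _ * _).
  have -> : [set inord x]%SET = idx [:: x].
    apply/setP => i; rewrite !inE -val_eqE /= inordK //; exact: s8.
  rewrite shuffle_sign_idx //; first by rewrite /multi_index /= andbT;
    exact: s8.
  rewrite /multi_index rem_uniq //=; apply/allP => y yr; apply: s8.
  exact: mem_rem yr.
rewrite scaler0; case: ifPn => // xA.
suff -> : (inord x |: A == idx s)%SET = false by rewrite mulr0.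
apply: contraNF Ar => /eqP As; apply/eqP.
rewrite -(setU1K xA) As (idx_rem x) // setU1K //.
Qed.

(** * Forms as lists of terms *)

Lemma innerDl (K : nzRingType) (a b c : form K) :
  inner (a + b) c = inner a c + inner b c.
Proof. by rewrite /inner -big_split; apply: eq_bigr => A _;
  rewrite ffunE mulrDl. Qed.

Lemma innerC (K : comNzRingType) (a b : form K) : inner a b = inner b a.
Proof. by apply: eq_bigr => A _; rewrite mulrC. Qed.

Lemma innerZl (K : numFieldType) (k : K) (a b : form K) :
  inner (k *: a) b = k * inner a b.
Proof. by rewrite /inner mulr_sumr; apply: eq_bigr => A _;
  rewrite ffunE -mulrA. Qed.

Lemma innerZr (K : numFieldType) (k : K) (a b : form K) :
  inner a (k *: b) = k * inner a b.
Proof. by rewrite innerC innerZl innerC. Qed.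

Lemma innerBl (K : numFieldType) (a b c : form K) :
  inner (a - b) c = inner a c - inner b c.
Proof. by rewrite innerDl -scaleN1r innerZl mulN1r. Qed.

Lemma inner_suml (K : numFieldType) (I : Type) (r : seq I) (F : I -> form K) b :
  inner (\sum_(i <- r) F i) b = \sum_(i <- r) inner (F i) b.
Proof.
elim/big_ind2 : _ => [|? ? ? ? <- <-|//]; last exact: innerDl.
by rewrite /inner big1 // => A _; rewrite ffunE mul0r.
Qed.

Lemma inner_sumr (K : numFieldType) (I : Type) (r : seq I) (F : I -> form K) a :
  inner a (\sum_(i <- r) F i) = \sum_(i <- r) inner a (F i).
Proof. by rewrite innerC inner_suml; apply: eq_bigr => i _; rewrite innerC. Qed.

Lemma inner_basisl (K : numFieldType) (S : {set 'I_8}) (a : form K) :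
  inner (basis_form K S) a = a S.
Proof.
rewrite /inner (bigD1 S) //= ffunE eqxx mul1r big1 ?addr0 // => A /negbTE AS.
by rewrite ffunE AS mul0r.
Qed.

Lemma inner_eq0 (R : realType) (a : form R) : inner a a = 0 -> a = 0.
Proof.
move=> aa; apply/ffunP => A; rewrite ffunE.
have aa_ge0 (B : {set 'I_8}) : true -> 0 <= a B * a B by rewrite -expr2 sqr_ge0.
move: aa => /eqP; rewrite psumr_eq0 // => /allP /(_ A).
by rewrite mem_index_enum -expr2 sqrf_eq0 => /(_ isT)/eqP.
Qed.

Lemma hodge_sum (K : numFieldType) (I : Type) (r : seq I) (F : I -> form K) :
  hodge (\sum_(i <- r) F i) = \sum_(i <- r) hodge (F i).
Proof.
apply/ffunP => A; rewrite ffunE !sum_ffunE mulr_sumr.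
by apply: eq_bigr => i _; rewrite ffunE.
Qed.

Lemma hodgeZ (K : numFieldType) (k : K) (a : form K) :
  hodge (k *: a) = k *: hodge a.
Proof. by apply/ffunP => A; rewrite !ffunE /GRing.scale /= mulrCA. Qed.

Lemma interior_sum (K : numFieldType) w (I : Type) (r : seq I)
  (F : I -> form K) :
  interior_prod w (\sum_(i <- r) F i) = \sum_(i <- r) interior_prod w (F i).
Proof.
apply/ffunP => A; rewrite ffunE !sum_ffunE.
under [RHS]eq_bigr do rewrite ffunE.
by rewrite exchange_big; apply: eq_bigr => i _; rewrite sum_ffunE mulr_sumr.
Qed.

Lemma interiorZ (K : numFieldType) w (k : K) (a : form K) :
  interior_prod w (k *: a) = k *: interior_prod w a.
Proof.
apply/ffunP => A; rewrite !ffunE scaler_sumr; apply: eq_bigr => i _.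
by rewrite ffunE /GRing.scale /=; ring.
Qed.

(* [(b, m, s)] stands for (-1)^b v_{m_1} ... v_{m_n} e^s: identities between
   forms with polynomial coefficients become computations on lists. *)
Definition term := (bool * seq nat * seq nat)%type.

Definition coef (K : pzRingType) (v : nat -> K) (t : bool * seq nat) : K :=
  let m := foldr (fun x c => v x * c) 1 t.2 in if t.1 then - m else m.

Definition peval (K : pzRingType) (v : nat -> K) (l : seq (bool * seq nat))
  : K :=
  foldr (fun t c => coef v t + c) 0 l.

Definition ev (K : numFieldType) (v : nat -> K) (l : seq term) : form K :=
  \sum_(t <- l) coef v t.1 *: basis_form K (idx t.2).

Definition wf (l : seq term) : bool := all (fun t => multi_index t.2) l.

(** Index lists are matched up to permutation because products concatenate them unsorted. *)
Definition tcoef (l : seq term) (s : seq nat) : seq (bool * seq nat) :=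
  [seq t.1 | t <- l & perm_eq t.2 s].

Definition tmul (k : bool * seq nat) (l : seq term) : seq term :=
  [seq (k.1 (+) t.1.1, k.2 ++ t.1.2, t.2) | t <- l].

Definition twedge (l1 l2 : seq term) : seq term :=
  flatten [seq [seq (t1.1.1 (+) t2.1.1 (+) odd (inversions t1.2 t2.2),
                     t1.1.2 ++ t2.1.2, t1.2 ++ t2.2)
               | t2 <- l2 & ~~ has (mem t1.2) t2.2] | t1 <- l1].

Definition thodge (l : seq term) : seq term :=
  [seq (let s' := [seq x <- iota 0 8 | x \notin t.2] in
        (t.1.1 (+) odd (inversions t.2 s'), t.1.2, s')) | t <- l].

(** Contraction with a generic vector: its component along e_x is the variable [x], which is
    prepended to the monomial. *)
Definition tinterior (l : seq term) : seq term :=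
  flatten [seq [seq (t.1.1 (+) odd (inversions [:: x] (rem x t.2)),
                     x :: t.1.2, rem x t.2) | x <- t.2] | t <- l].

Definition tinner (l1 l2 : seq term) : seq (bool * seq nat) :=
  flatten [seq [seq (t1.1.1 (+) t2.1.1, t1.1.2 ++ t2.1.2)
               | t2 <- l2 & perm_eq t2.2 t1.2] | t1 <- l1].

Lemma coefE (K : pzRingType) (v : nat -> K) b m :
  coef v (b, m) = (-1) ^+ b * \prod_(x <- m) v x.
Proof. by rewrite /coef mulr_sign unlock. Qed.

Lemma pevalE (K : pzRingType) (v : nat -> K) l :
  peval v l = \sum_(t <- l) coef v t.
Proof. by rewrite unlock. Qed.

Lemma ev_cat (K : numFieldType) (v : nat -> K) l1 l2 :
  ev v (l1 ++ l2) = ev v l1 + ev v l2.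
Proof. exact: big_cat. Qed.

Lemma ev_tmul (K : numFieldType) (v : nat -> K) k l :
  ev v (tmul k l) = coef v k *: ev v l.
Proof.
rewrite /ev /tmul big_map scaler_sumr; apply: eq_bigr => -[[b m] s] _ /=.
case: k => b' m'; rewrite !coefE scalerA signr_addb big_cat /=; congr (_ *: _).
by ring.
Qed.

Lemma ev_twedge (K : numFieldType) (v : nat -> K) l1 l2 : wf l1 -> wf l2 ->
  wedge (ev v l1) (ev v l2) = ev v (twedge l1 l2).
Proof.
move=> /allP wf1 /allP wf2.
rewrite /ev wedge_suml /twedge big_flatten big_map big_seq [RHS]big_seq.
apply: eq_bigr => -[[b m] s] /wf1 /= ws.
rewrite wedge_sumr big_map big_filter big_seq [RHS]big_seq_cond big_mkcondr /=.
apply: eq_bigr => -[[b' m'] s'] /wf2 /= ws'.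
rewrite wedgeZl wedgeZr wedge_basis_idx // if_neg.
case: ifP => _; first by rewrite !scaler0.
rewrite !scalerA !coefE !signr_addb signr_odd big_cat /=; congr (_ *: _).
by ring.
Qed.

Lemma ev_thodge (K : numFieldType) (v : nat -> K) l : wf l ->
  hodge (ev v l) = ev v (thodge l).
Proof.
move=> /allP wfl; rewrite /ev /thodge hodge_sum big_map big_seq [RHS]big_seq.
apply: eq_bigr => -[[b m] s] /wfl /= ws.
rewrite hodgeZ hodge_basis_idx // scalerA !coefE signr_addb signr_odd.
by congr (_ *: _); ring.
Qed.

Lemma ev_tinterior (K : numFieldType) (v : nat -> K) l : wf l ->
  interior_prod (\row_(i < 8) v i) (ev v l) = ev v (tinterior l).
Proof.
move=> /allP wfl; rewrite /ev /tinterior interior_sum big_flatten big_map.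
rewrite big_seq [RHS]big_seq.
apply: eq_bigr => -[[b m] s] /wfl /= ws.
rewrite interiorZ interior_basis_idx // big_map scaler_sumr.
rewrite big_seq [RHS]big_seq; apply: eq_bigr => x xs.
rewrite mxE inordK; last by case/andP: ws => _ /allP; apply.
rewrite scalerA !coefE signr_addb signr_odd big_cons.
by congr (_ *: _); ring.
Qed.

Lemma ev_idx (K : numFieldType) (v : nat -> K) l s : wf l -> multi_index s ->
  ev v l (idx s) = peval v (tcoef l s).
Proof.
move=> /allP wfl ws; rewrite pevalE /tcoef big_map big_filter sum_ffunE.
rewrite big_seq [RHS]big_seq_cond big_mkcondr; apply: eq_bigr => t /wfl wt.
rewrite !ffunE -idx_inj // eq_sym; case: eqP => _; rewrite /GRing.scale /=.
  by rewrite mulr1.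
by rewrite mulr0.
Qed.

Lemma inner_ev (K : numFieldType) (v : nat -> K) l1 l2 : wf l1 -> wf l2 ->
  inner (ev v l1) (ev v l2) = peval v (tinner l1 l2).
Proof.
move=> /allP wf1 wf2; rewrite pevalE /tinner big_flatten big_map inner_suml.
rewrite big_seq [RHS]big_seq; apply: eq_bigr => -[[b m] s] /wf1 /= ws.
rewrite innerZl inner_basisl ev_idx // pevalE /tcoef !big_map mulr_sumr.
apply: eq_bigr => -[[b' m'] s'] _ /=.
by rewrite !coefE signr_addb big_cat /=; ring.
Qed.

(** Unlike [all], it accepts propositions and, on an explicit list, unfolds to a conjunction whose
    members [ring] or [lra] can close. *)
Fixpoint every (T : Type) (P : T -> Prop) (s : seq T) : Prop :=
  if s is x :: s' then P x /\ every P s' else True.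

Lemma everyP (T : eqType) (P : T -> Prop) (s : seq T) :
  every P s <-> {in s, forall x, P x}.
Proof.
elim: s => [|x s IH] /=; first by split.
split=> [[Px /IH Ps] y|Ps]; first by rewrite inE => /orP[/eqP -> //|/Ps].
split; first exact: Ps (mem_head _ _).
by apply/IH => y ys; apply: Ps; rewrite inE ys orbT.
Qed.

(** Both forms vanish off the indices in [ks], so finitely many coefficients decide the equality. *)
Lemma ev_ext (K : numFieldType) (ks : seq (seq nat)) (v v' : nat -> K) l1 l2 :
  wf l1 -> wf l2 -> all multi_index ks ->
  all (fun t => has (perm_eq t.2) ks) (l1 ++ l2) ->
  every (fun s => peval v (tcoef l1 s) = peval v' (tcoef l2 s)) ks ->
  ev v l1 = ev v' l2.
Proof.
move=> wf1 wf2 /allP wfk lk /everyP l12; apply/ffunP => A.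
have [/hasP[s sk /eqP ->]|/hasPn nA] := boolP (has (fun s => A == idx s) ks).
  by rewrite !ev_idx ?wfk // l12.
have nAl (t : term) : t \in l1 ++ l2 -> multi_index t.2 ->
  (A == idx t.2) = false.
  move=> tl wt; have /hasP[s sk ts] := allP lk _ tl.
  apply: contraNF (nA s sk) => /eqP ->; rewrite idx_inj //; exact: wfk.
rewrite /ev !sum_ffunE !big_seq !big1 // => t tl;
  rewrite !ffunE nAl ?scaler0 //.
- by rewrite mem_cat tl orbT.
- exact: (allP wf2).
- by rewrite mem_cat tl.
- exact: (allP wf1).
Qed.

(** * The Spin(7)-form and its 7-dimensional components *)

Lemma mono_idx (K : numFieldType) (s : seq nat) :
  sorted ltn s -> all (gtn 8) s -> mono K s = basis_form K (idx s).
Proof.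
have idx1 (x : nat) : (x < 8)%N ->
  covec K (inord x) = basis_form K (idx [:: x]).
  move=> x8; apply/ffunP => A; rewrite !ffunE; congr (_ == _)%:R.
  by apply/setP => i; rewrite !inE -val_eqE /= inordK.
have mi s' : sorted ltn s' -> all (gtn 8) s' -> multi_index s'.
  by move=> ss' s8; rewrite /multi_index s8 (sorted_uniq ltn_trans ltnn ss').
elim: s => [_ _|x s IH xs /andP[x8 s8]] /=.
  by apply/ffunP => A; rewrite !ffunE; congr (_ == _)%:R; apply/setP => i;
    rewrite !inE.
have ss := path_sorted xs.
rewrite IH // idx1 // wedge_basis_idx ?mi ?(path_sorted xs) //=;
  last by rewrite andbT.
have xlt := order_path_min ltn_trans xs.
rewrite (_ : inversions _ _ = 0%N) ?scale1r.
  case: hasP => // -[y ys]; rewrite /= inE => /eqP yx.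
  by have := allP xlt _ ys; rewrite yx /= ltnn.
rewrite /inversions /= cats0 count_map -[RHS](count_pred0 s).
by apply: eq_in_count => y ys /=; apply/negbTE;
  rewrite -leqNgt ltnW // (allP xlt).
Qed.

Definition constant (l : seq (bool * seq nat)) : seq term :=
  [seq (t.1, [::], t.2) | t <- l].

Definition phi_terms : seq term := constant
  [:: (false, [:: 1; 2; 3]); (false, [:: 1; 4; 5]); (false, [:: 1; 6; 7]);
      (false, [:: 2; 4; 6]); (true, [:: 2; 5; 7]); (true, [:: 3; 4; 7]);
      (true, [:: 3; 5; 6])]%N.

Definition star7_phi_terms : seq term := constant
  [:: (false, [:: 4; 5; 6; 7]); (false, [:: 2; 3; 6; 7]);
      (false, [:: 2; 3; 4; 5]); (false, [:: 1; 3; 5; 7]);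
      (true, [:: 1; 3; 4; 6]); (true, [:: 1; 2; 5; 6]);
      (true, [:: 1; 2; 4; 7])]%N.

Definition Phi_terms : seq term :=
  twedge [:: (false, [::], [:: 0])] phi_terms ++ star7_phi_terms.

Lemma phi_ev (K : numFieldType) (v : nat -> K) : phi K = ev v phi_terms.
Proof.
rewrite /phi /ev !mono_idx // unlock /= /coef /=.
by rewrite !scale1r !scaleN1r addr0 !addrA.
Qed.

Lemma star7_phi_ev (K : numFieldType) (v : nat -> K) :
  star7_phi K = ev v star7_phi_terms.
Proof.
rewrite /star7_phi /ev !mono_idx // unlock /= /coef /=.
by rewrite !scale1r !scaleN1r addr0 !addrA.
Qed.

Lemma covec_ev (K : numFieldType) (v : nat -> K) (i : 'I_8) :
  covec K i = ev v [:: (false, [::], [:: val i])].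
Proof.
rewrite /ev big_seq1 /coef /= scale1r; apply/ffunP => A; rewrite !ffunE.
by congr (_ == _)%:R; apply/setP => k; rewrite !inE.
Qed.

Lemma Phi_ev (K : numFieldType) (v : nat -> K) : Phi K = ev v Phi_terms.
Proof.
by rewrite /Phi (covec_ev v) (phi_ev v) (star7_phi_ev v) ev_twedge // -ev_cat.
Qed.

(** * Explicit orthogonal bases of the 7-dimensional components *)

Definition orthogonal_family (R : realType) (n : nat) (N : R)
    (b : 'I_n -> form R) : Prop :=
  forall k l, inner (b k) (b l) = if k == l then N else 0.

(** As [xget] defaults to 0, a vanishing projection says something only once a projection is known
    to exist; the Fourier sum in [exP] provides one. Definiteness of [inner] gives the converse. *)
Lemma orth_proj_eq0 (R : realType) (n : nat) (N : R) (b : 'I_n -> form R)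
    (U : set (form R)) (a : form R) : N != 0 -> orthogonal_family N b ->
  (forall c, U c <-> exists t : 'I_n -> R, c = \sum_(k < n) t k *: b k) ->
  orth_proj U a = 0 <-> forall k, inner a (b k) = 0.
Proof.
move=> N0 ob UP.
pose P := [set c | U c /\ forall d, U d -> inner (a - c) d = 0].
have bU k : U (b k).
  apply/UP; exists (fun l => (l == k)%:R); rewrite (bigD1 k) //= eqxx scale1r.
  by rewrite big1 ?addr0 // => l /negbTE ->; rewrite scale0r.
have perpU c : (forall k, inner c (b k) = 0) -> forall d, U d -> inner c d = 0.
  move=> cb d /UP[t ->]; rewrite inner_sumr big1 // => k _.
  by rewrite innerZr cb mulr0.
have exP : P (\sum_(k < n) (inner a (b k) / N) *: b k).
  split; first by apply/UP; eexists.
  apply: perpU => k; rewrite innerBl inner_suml (bigD1 k) //= innerZl ob eqxx.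
  rewrite divfK // big1 ?addr0 ?subrr // => l /negbTE lk.
  by rewrite innerZl ob lk mulr0.
have [Uc ac] : P (orth_proj U a) by apply: xgetPex; eexists; exact: exP.
split=> [p0 k|ab]; first by rewrite -(ac _ (bU k)) p0 subr0.
apply: inner_eq0.
by have /eqP := ac _ Uc; rewrite innerBl (perpU _ ab _ Uc) sub0r oppr_eq0 =>
  /eqP.
Qed.

Lemma card_idx (s : seq nat) : multi_index s -> #|idx s| = size s.
Proof.
move=> /andP[us s8]; rewrite -(size_map (fun n => inord n : 'I_8)).
rewrite -(card_uniqP _); last by rewrite map_inj_in_uniq //;
  exact: inord_inj_in.
by apply: eq_card => i; rewrite inE mem_map_inord.
Qed.

Lemma homogeneous_ev (K : numFieldType) (v : nat -> K) (k : nat)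
  (l : seq term) :
  wf l -> all (fun t => size t.2 == k) l -> homogeneous k (ev v l).
Proof.
move=> /allP wfl /allP sl A.
have [/hasP[t tl /eqP ->] _|/hasPn nA] := boolP (has (fun t : term =>
  A == idx t.2) l).
  by rewrite card_idx ?wfl //; apply/eqP/sl.
rewrite /ev sum_ffunE big_seq big1 ?eqxx // => t /nA /negbTE tA.
by rewrite !ffunE tA scaler0.
Qed.

Definition pairs : seq (seq nat) :=
  [seq [:: i; j] | i <- iota 0 8, j <- iota i.+1 (7 - i)]%N.

(** The generic 2-form: variable 8 i + j is its coefficient on e^{ij}, a numbering undone by
    quotient and remainder in [homogeneous2_ev]. *)
Definition pair_terms : seq term :=
  [seq (false, [:: 8 * nth 0 s 0 + nth 0 s 1], s) | s <- pairs]%N.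

Lemma card2_idx (A : {set 'I_8}) :
  #|A| = 2%N -> exists2 s, s \in pairs & A = idx s.
Proof.
move=> /eqP/cards2P[x [y [xy ->]]].
wlog xy' : x y xy / (x < y)%N.
  move=> H; have [/H|yx|/val_inj] := ltngtP x y; first exact.
    by rewrite finset.setUC; apply: H => //; rewrite eq_sym.
  by move=> xy'; rewrite xy' eqxx in xy.
exists [:: val x; val y]; last by apply/setP => i; rewrite !inE.
apply/allpairsPdep; exists (val x), (val y); split=> //.
  by rewrite mem_iota /=.
rewrite mem_iota xy' /= addSn subnKC // -ltnS; exact: ltn_ord.
Qed.

Lemma homogeneous2_ev (K : numFieldType) (a : form K) : homogeneous 2 a ->
  a = ev (fun n => a (idx [:: n %/ 8; n %% 8]%N)) pair_terms.
Proof.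
move=> ha; apply/ffunP => A.
have [A2|nA] := eqVneq #|A| 2%N; last first.
  have -> : a A = 0 by apply/eqP; apply: contraNT nA => /ha ->.
  apply/esym/eqP; apply: contraNT nA => /(homogeneous_ev (k := 2)) -> //.
have {A2}[s sp ->] := card2_idx A2.
rewrite ev_idx //; last first.
  by move: s sp; apply/allP; vm_compute.
have pe : all (fun s => tcoef pair_terms s == [:: (false, [:: 8 * nth 0 s 0
  + nth 0 s 1]%N)]) pairs by vm_compute.
have pd : all (fun s => [:: (8 * nth 0 s 0 + nth 0 s 1) %/ 8; (8 * nth 0 s 0
  + nth 0 s 1) %% 8]%N == s) pairs by vm_compute.
rewrite (eqP (allP pe _ sp)) /peval /= /coef /= (eqP (allP pd _ sp)).
by rewrite mulr1 addr0.
Qed.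

Definition sextuples : seq (seq nat) :=
  [seq [seq x <- iota 0 8 | x \notin s] | s <- pairs].

Ltac expand_every :=
  match goal with
  | |- context [every _ ?s] =>
      let x := eval vm_compute in s in
      have -> : s = x by vm_cast_no_check (erefl x)
  end; cbn [every];
  repeat match goal with |- _ /\ _ => split | |- True => exact: I end.

(** The virtual machine sees only signs and numerals; the coefficients stay symbolic, as [ring] and
    [lra] require. *)
Ltac compute_coefs :=
  repeat match goal with
  | |- context [tcoef ?l ?s] =>
      let x := eval vm_compute in (tcoef l s) in
      have -> : tcoef l s = x by vm_cast_no_check (erefl x)
  | |- context [tinner ?l ?s] =>
      let x := eval vm_compute in (tinner l s) in
      have -> : tinner l s = x by vm_cast_no_check (erefl x)
  end; rewrite /peval /coef /=.

Definition combination (n : nat) (b : nat -> seq term) : seq term :=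
  flatten [seq tmul (false, [:: k]) (b k) | k <- iota 0 n].

Lemma ev_combination (K : numFieldType) (v : nat -> K) (n : nat) b :
  ev v (combination n b) = \sum_(k < n) v k *: ev v (b k).
Proof.
rewrite {1}/ev big_flatten big_map -[in LHS](subn0 n) big_mkord.
by apply: eq_bigr => k _; rewrite -[LHS]/(ev v _) ev_tmul /coef /= mulr1.
Qed.

Lemma ev_constant (K : numFieldType) (v v' : nat -> K) l :
  all (fun t => t.1.2 == [::]) l -> ev v l = ev v' l.
Proof.
move=> /allP cl; rewrite /ev big_seq [RHS]big_seq; apply: eq_bigr => t /cl.
by rewrite /coef => /eqP ->.
Qed.

(* 4 times the projection of e^{0,k+1} to Lambda^2_7. *)
Definition b27 (k : nat) : seq term :=
  let a := [:: (false, [::], [:: 0; k.+1]%N)] in a ++ thodge (twedge Phi_terms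
    a).

Lemma b27_constant (K : numFieldType) (v t : nat -> K) k :
  (k < 7)%N -> ev v (b27 k) = ev t (b27 k).
Proof.
move=> k7; apply: ev_constant; move: k k7.
by do 7![case=> [_|]; first by vm_compute].
Qed.

(** The map alpha -> *(Phi /\ alpha) has eigenvalues 3 and -1 on 2-forms, so alpha + *(Phi /\
    alpha), the shape of [b27 k], lies in the eigenspace of 3. Conversely, a solution is determined
    by its coefficients on e^{01}, ..., e^{07}. *)
Lemma Lambda27P (R : realType) (v : nat -> R) (a : form R) :
  Lambda27 a <-> exists t : 'I_7 -> R, a = \sum_(k < 7) t k *: ev v (b27 k).
Proof.
split=> [[ha]|[t ->]]; last first.
  pose t' n := t (inord n).
  rewrite (eq_bigr (fun k : 'I_7 => t' k *: ev t' (b27 k))); last first.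
    by move=> k _; rewrite /t' inord_val (b27_constant v t').
  rewrite -ev_combination; split; first by apply: homogeneous_ev; vm_compute.
  rewrite (Phi_ev t') ev_twedge; [|by vm_compute|by vm_compute].
  rewrite ev_thodge; last by vm_compute.
  have -> (c : form R) : 3%:R *: c = c + c + c
    by rewrite scaler_nat !mulrS addrA addr0.
  rewrite -!ev_cat; apply: (ev_ext (ks := sextuples));
    [by vm_compute|by vm_compute|by vm_compute|by vm_compute|].
  expand_every; compute_coefs; ring.
  move: (homogeneous2_ev ha); move: (fun n : nat => a _) => u -> {a ha}.
  rewrite (Phi_ev u) ev_twedge // ev_thodge // => eq6.
  (* Variable n + 1 is 8 * 0 + (n + 1), the coefficient on e^{0,n+1}; among the seven forms this
     monomial occurs in [b27 n] alone, with coefficient 1. *)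
  pose t n := u n.+1; exists (fun k => t k).
  under eq_bigr => k _ do rewrite (b27_constant v t) //.
  rewrite -ev_combination.
  have : every (fun s => peval u (tcoef (twedge Phi_terms pair_terms) s) =
      3%:R * peval u (tcoef (thodge pair_terms) s)) sextuples.
    apply/everyP => s s6; have ws : multi_index s.
      by move: s s6; apply/allP; vm_compute.
    have := congr1 (fun f : form R => f (idx s)) eq6.
    by rewrite /= ffunE !ev_idx //; vm_compute.
  expand_every; compute_coefs => eqs.
  apply: (ev_ext (ks := pairs));
    [by vm_compute|by vm_compute|by vm_compute|by vm_compute|].
  decompose [and] eqs; clear eqs eq6.
  (* The 28 equations split into seven blocks of four unknowns, so only those mentioning the
     coefficient at hand are passed to [lra]. *)
  expand_every; compute_coefs; rewrite /t;
    match goal with |- u ?n * 1 + 0 = _ =>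
    repeat match goal with E : _ = _ |- _ =>
      lazymatch type of E with context [u n] => fail | _ => clear E end end;
    lra end.
Qed.

Definition covector_terms : seq term :=
  [seq (false, [:: j], [:: j]) | j <- iota 1 7].

(** Both summands use variable j for the coefficient of alpha on e^j, so the expression is linear in
    the variables 1 to 7 and [b47] can read off each part. *)
Definition Lambda47_terms : seq term :=
  twedge [:: (false, [::], [:: 0%N])] (tinterior star7_phi_terms)
  ++ tmul (true, [::]) (twedge covector_terms phi_terms).

(* The element of Lambda^4_7 given by alpha = e^{k+1}. *)
Definition b47 (k : nat) : seq term :=
  [seq (t.1.1, [::], t.2) | t <- Lambda47_terms & t.1.2 == [:: k.+1]].

Lemma b47_constant (K : numFieldType) (v t : nat -> K) k :
  ev v (b47 k) = ev t (b47 k).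
Proof. by apply: ev_constant; rewrite all_map; apply/allP. Qed.

Lemma Lambda47_ev (R : realType) (v : nat -> R) : v 0%N = 0 ->
  let alpha := \sum_(j < 8) v j *: covec R j in
  wedge (covec R 0) (interior_prod (sharp alpha) (star7_phi R))
    - wedge alpha (phi R)
  = \sum_(k < 7) v k.+1 *: ev v (b47 k).
Proof.
move=> v0 alpha.
have -> : sharp alpha = \row_(j < 8) v j.
  apply/rowP => j; rewrite !mxE sum_ffunE (bigD1 j) //= big1 => [|i /negbTE ij].
    by rewrite !ffunE eqxx /GRing.scale /= mulr1 addr0.
  by rewrite !ffunE (inj_eq finset.set1_inj) eq_sym ij scaler0.
have -> : alpha = ev v covector_terms.
  rewrite /alpha big_ord_recl v0 scale0r add0r /ev big_map.
  rewrite -[iota 1 7]/[seq i.+1 | i <- iota 0 7] big_map.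
  rewrite -[iota 0 7]/(index_iota 0 7) big_mkord; apply: eq_bigr => j _.
  by rewrite (covec_ev v) /ev big_seq1 /coef /= mulr1 scale1r.
rewrite (covec_ev v) (star7_phi_ev v) (phi_ev v) ev_tinterior // ev_twedge //.
rewrite ev_twedge // -scaleN1r -[- 1](_ : coef v (true, [::]) =
  - 1) // -ev_tmul -ev_cat.
pose t n := v n.+1.
under eq_bigr => k _ do rewrite (b47_constant v t) -/(t k).
rewrite -(ev_combination t).
by apply: (ev_ext (ks := [seq t.2 | t <- Lambda47_terms])); vm_compute.
Qed.

Lemma Lambda47P (R : realType) (v : nat -> R) (a : form R) :
  Lambda47 a <-> exists t : 'I_7 -> R, a = \sum_(k < 7) t k *: ev v (b47 k).
Proof.
split=> [[c [c0 ->]]|[t ->]].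
  pose u n := c (inord n).
  have u0 : u 0%N = 0 by rewrite -c0; congr c; apply/val_inj; rewrite /= inordK.
  have cu (j : 'I_8) : true -> c j *: covec R j = u j *: covec R j.
    by rewrite /u inord_val.
  exists (fun k => u k.+1); rewrite /= (eq_bigr _ cu) Lambda47_ev //.
  by apply: eq_bigr => k _; rewrite (b47_constant v u).
pose u n := if n is k.+1 then t (inord k) else 0.
exists (fun j : 'I_8 => u j); split=> //=; rewrite Lambda47_ev //.
by apply: eq_bigr => k _; rewrite (b47_constant v u) /= inord_val.
Qed.

Lemma orthogonal_b27 (R : realType) (v : nat -> R) :
  orthogonal_family 4%:R (fun k : 'I_7 => ev v (b27 k)).
Proof.
(* The squared norm counts the four unit monomials of [b27 k], written in the nested shape that
   [peval] produces; [b47 k] has eight. *)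
have -> : 4%:R = 1 + (1 + (1 + (1 + 0))) :> R by ring.
have H : all (fun k => all (fun l => tinner (b27 k) (b27 l) ==
    (if k == l then nseq 4 (false, [::]) else [::])) (iota 0 7)) (iota 0 7).
  by vm_compute.
have wf27 : all (fun k => wf (b27 k)) (iota 0 7) by vm_compute.
have in7 (k : 'I_7) : val k \in iota 0 7 by rewrite mem_iota /=.
move=> k l.
rewrite (inner_ev _ (allP wf27 _ (in7 k)) (allP wf27 _ (in7 l))).
rewrite (eqP (allP (allP H _ (in7 k)) _ (in7 l))) -val_eqE /=.
by case: ifP.
Qed.

Lemma orthogonal_b47 (R : realType) (v : nat -> R) :
  orthogonal_family 8%:R (fun k : 'I_7 => ev v (b47 k)).
Proof.
have -> : 8%:R = 1 + (1 + (1 + (1 + (1 + (1 + (1 + (1 + 0))))))) :> R by ring.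
have H : all (fun k => all (fun l => tinner (b47 k) (b47 l) ==
    (if k == l then nseq 8 (false, [::]) else [::])) (iota 0 7)) (iota 0 7).
  by vm_compute.
have wf47 : all (fun k => wf (b47 k)) (iota 0 7) by vm_compute.
have in7 (k : 'I_7) : val k \in iota 0 7 by rewrite mem_iota /=.
move=> k l.
rewrite (inner_ev _ (allP wf47 _ (in7 k)) (allP wf47 _ (in7 l))).
rewrite (eqP (allP (allP H _ (in7 k)) _ (in7 l))) -val_eqE /=.
by case: ifP.
Qed.

Lemma orth_proj27_eq0 (R : realType) (v : nat -> R) (a : form R) :
  orth_proj (@Lambda27 R) a = 0 <-> forall k : 'I_7, inner a (ev v (b27 k)) = 0.
Proof.
apply: orth_proj_eq0 (orthogonal_b27 v) (Lambda27P v).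
by rewrite pnatr_eq0.
Qed.

Lemma orth_proj47_eq0 (R : realType) (v : nat -> R) (a : form R) :
  orth_proj (@Lambda47 R) a = 0 <-> forall k : 'I_7, inner a (ev v (b47 k)) = 0.
Proof.
apply: orth_proj_eq0 (orthogonal_b47 v) (Lambda47P v).
by rewrite pnatr_eq0.
Qed.

(** * The Cayley equality on graphs *)

Lemma enum_idx (s : seq nat) : sorted ltn s -> all (gtn 8) s ->
  enum (idx s) = [seq inord x : 'I_8 | x <- s].
Proof.
move=> ss s8; apply: (inj_map val_inj).
have -> : [seq val i | i <- [seq inord x : 'I_8 | x <- s]] = s.
  by rewrite -map_comp map_id_in // => x xs /=; rewrite inordK //;
    apply: (allP s8).
apply: (irr_sorted_eq ltn_trans ltnn) => // [|x].
  apply: (subseq_sorted ltn_trans _ (iota_ltn_sorted 0 8)).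
  by rewrite -val_enum_ord map_subseq // {1}/enum_mem -enumT filter_subseq.
apply/mapP/idP => [[i +]|xs]; first by rewrite mem_enum inE => ? ->.
have x8 := allP s8 _ xs.
by exists (Ordinal x8) => //; rewrite mem_enum inE.
Qed.

(** Expansion along row [i] with the columns listed in [s]: unlike [\det], it unfolds to a
    polynomial that [ring] can read. *)
Fixpoint laplace (K : pzRingType) (n : nat) (a : nat -> nat -> K) (i : nat)
    (s : seq nat) : K :=
  if n is n'.+1 then
    foldr (fun k c =>
      let m := a i (nth 0%N s k) * laplace n' a i.+1 (take k s ++ drop k.+1 s)
        in
      (if odd k then - m else m) + c) 0 (iota 0 n)
  else 1.

Lemma det_laplace (K : comPzRingType) (n : nat) (a : nat -> nat -> K) (i0 : nat)
    (s : seq nat) : size s = n ->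
  \det (\matrix_(i < n, j < n) a (i0 + i)%N (nth 0%N s j)) = laplace n a i0 s.
Proof.
elim: n i0 s => [|n IH] i0 s sn; first by rewrite det_mx00.
rewrite (expand_det_row _ ord0) [RHS]/laplace -/laplace.
pose F k := (-1) ^+ odd k * (a i0 (nth 0%N s k) *
  laplace n a i0.+1 (take k s ++ drop k.+1 s)).
transitivity (\sum_(k <- iota 0 n.+1) F k); last first.
  rewrite unlock; elim: (iota _ _) => //= k l ->.
  by rewrite /F mulr_sign.
rewrite -[iota 0 n.+1]/(index_iota 0 n.+1) big_mkord.
apply: eq_bigr => j _; rewrite mxE /F mulrCA signr_odd addn0 /cofactor add0n.
congr (_ * (_ * _)); rewrite -IH; last first.
  rewrite size_cat size_take size_drop sn ltn_ord; have := ltn_ord j; lia.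
congr (\det _); apply/matrixP => i k; rewrite !mxE /= /bump leq0n add1n addSnnS.
congr (a _ _); rewrite nth_cat size_take sn ltn_ord nth_drop.
case: ltnP => kj; first by rewrite add0n nth_take.
congr (nth _ _ _); lia.
Qed.

Lemma form_eval_sum (K : numFieldType) (I : Type) (r : seq I) (F : I -> form K)
    (c : I -> K) (k : nat) (W : 'M[K]_(k, 8)) :
  form_eval (\sum_(i <- r) c i *: F i) W =
    \sum_(i <- r) c i * form_eval (F i) W.
Proof.
rewrite /form_eval; under eq_bigr => A _ do rewrite sum_ffunE mulr_suml.
rewrite exchange_big; apply: eq_bigr => i _; rewrite mulr_sumr.
by apply: eq_bigr => A _; rewrite ffunE -mulrA.
Qed.

Lemma form_eval_basis (K : numFieldType) (n : nat) (a : nat -> nat -> K)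
    (s : seq nat) : sorted ltn s -> all (gtn 8) s -> size s = n ->
  form_eval (basis_form K (idx s)) (\matrix_(i < n, x < 8) a i x) =
    laplace n a 0 s.
Proof.
move=> ss s8 sn; have ms : multi_index s.
  by rewrite /multi_index s8 (sorted_uniq ltn_trans ltnn ss).
rewrite /form_eval (bigD1 (idx s)) ?card_idx ?sn //= big1; last first.
  by move=> A /andP[_ /negbTE As]; rewrite ffunE As mul0r.
rewrite ffunE eqxx mul1r addr0 -det_laplace //; congr (\det _).
apply/matrixP => i j; rewrite !mxE add0n enum_idx //.
rewrite (nth_map 0%N) ?sn // inordK //; apply: (allP s8).
by rewrite mem_nth // sn.
Qed.

(* The variable of index 4 i + a is the derivative of f^(4+a) along x^i. *)
Definition curvature_terms : seq term :=
  [seq (false, [:: 4 * i + a], [:: i; 4 + a]) | i <- iota 0 4, a <- iota 0 4]%N.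

(** The matrix (1 | J), in the same variables as [curvature_terms]. *)
Definition graph_entry (K : pzRingType) (v : nat -> K) (i x : nat) : K :=
  if (x < 4)%N then if i == x then 1 else 0 else v (4 * i + (x - 4))%N.

Definition curvature_power (n : nat) : seq term :=
  iter n (twedge curvature_terms) [:: (false, [::], [::])].

Lemma wedge_exp_curvature (K : numFieldType) (v : nat -> K) (n : nat) :
  (n <= 3)%N -> wedge_exp (ev v curvature_terms) n = ev v (curvature_power n).
Proof.
move=> n3; have: all (fun m => wf (curvature_power m)) (iota 0 4) by vm_compute.
move=> /allP wfp; rewrite /wedge_exp; elim: n n3 => [_|n IH n3] /=.
  rewrite /ev big_seq1 /coef /= scale1r; apply/ffunP => A; rewrite !ffunE.
  by congr (_ == _)%:R; apply/setP => i; rewrite !inE.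
by rewrite IH ?(ltnW n3) // ev_twedge // wfp // mem_iota; apply: ltnW n3.
Qed.

(** The minus sign comes from (sqrt(-1) omega)^3 = - sqrt(-1) omega^3. *)
Definition odd_test (K : numFieldType) (v : nat -> K) (k : nat) : K :=
  peval v (tinner curvature_terms (b27 k))
  - 6%:R^-1 * peval v (tinner (thodge (curvature_power 3)) (b27 k)).

Definition even_test (K : numFieldType) (v : nat -> K) (k : nat) : K :=
  peval v (tinner (curvature_power 2) (b47 k)).

Definition Phi_test (K : numFieldType) (v : nat -> K) : K :=
  foldr (fun t c => (if t.1.1 then - laplace 4 (graph_entry v) 0 t.2
                     else laplace 4 (graph_entry v) 0 t.2) + c) 0 Phi_terms.

Definition gram_entry (K : numFieldType) (v : nat -> K) (i k : nat) : K :=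
  let w a := v (4 * i + a)%N * v (4 * k + a)%N in
  (if i == k then 1 else 0) + (w 0%N + (w 1%N + (w 2%N + w 3%N))).

Definition minor2 (K : numFieldType) (v : nat -> K) (i k a b : nat) : K :=
  v (4 * i + a)%N * v (4 * k + b)%N - v (4 * i + b)%N * v (4 * k + a)%N.

Definition minor3 (K : numFieldType) (v : nat -> K) (i k l a b c : nat) : K :=
  v (4 * i + a)%N * minor2 v k l b c - v (4 * i + b)%N * minor2 v k l a c
  + v (4 * i + c)%N * minor2 v k l a b.

(* The coefficient of omega - *omega^3/6 on e^i /\ e^(4+a). *)
Definition cofactor_diff (K : numFieldType) (v : nat -> K) (i a : nat) : K :=
  let r := [seq x <- iota 0 4 | x != i] in
  let s := [seq x <- iota 0 4 | x != a] in
  let m := minor3 v (nth 0 r 0) (nth 0 r 1) (nth 0 r 2)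
                    (nth 0 s 0) (nth 0 s 1) (nth 0 s 2) in
  v (4 * i + a)%N - if odd (i + a) then - m else m.

(** For these k the monomials of [b27 k] have both indices on the base or both on the fibre, while
    those of omega and *omega^3 have one of each. *)
Lemma odd_test0 (K : numFieldType) (v : nat -> K)
  k : (k < 3)%N -> odd_test v k = 0.
Proof.
by case: k => [|[|[|//]]] _; rewrite /odd_test; compute_coefs;
  rewrite mulr0 subr0.
Qed.

(** Each coefficient of *omega^3 is, up to sign, a 3 x 3 minor of J counted once for each of the 3!
    orders of the factors, which cancels the factor 1/6. *)
Lemma odd_testE (K : numFieldType) (v : nat -> K) :
  let u := cofactor_diff v in
  [/\ odd_test v 3 = u 0 0 - u 1 1 - u 2 2 + u 3 3,
      odd_test v 4 = u 0 1 + u 1 0 + u 2 3 + u 3 2,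
      odd_test v 5 = u 0 2 - u 1 3 + u 2 0 - u 3 1
    & odd_test v 6 = u 0 3 + u 1 2 - u 2 1 - u 3 0].
Proof.
by split; rewrite /odd_test; compute_coefs;
  rewrite /cofactor_diff /minor3 /minor2 /=; field.
Qed.

(** For these k every monomial of [b47 k] has an odd number of base indices, while those of omega^2
    have two. *)
Lemma even_test0 (K : numFieldType) (v : nat -> K) k :
  (2 < k < 7)%N -> even_test v k = 0.
Proof.
by case: k => [|[|[|[|[|[|[|//]]]]]]] // _; rewrite /even_test; compute_coefs.
Qed.

(** The factor 2 counts the two orders of the factors in omega /\ omega; its square cancels
    [4%:R^-1] in [cayley_identity]. *)
Lemma even_testE (K : numFieldType) (v : nat -> K) :
  let m2 := minor2 v in
  [/\ even_test v 0 = 2%:R * (- m2 0 3 1 3 + m2 0 3 0 2 + m2 0 2 1 2 + m2 0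
    2 0 3 + m2 1 2 0 2 - m2 1 2 1 3 - m2 1 3 0 3 - m2 1 3 1 2),
      even_test v 1 = 2%:R * (- m2 0 3 2 3 - m2 0 3 0 1 - m2 0 1 1 2 - m2 0
    1 0 3 - m2 1 2 0 1 - m2 1 2 2 3 - m2 2 3 0 3 - m2 2 3 1 2)
    & even_test v 2 = 2%:R * (m2 0 2 2 3 + m2 0 2 0 1 + m2 0 1 1 3 - m2 0 1
    0 2 - m2 1 3 0 1 - m2 1 3 2 3 - m2 2 3 0 2 + m2 2 3 1 3)].
Proof.
by split; rewrite /even_test; compute_coefs; rewrite /minor2 /=; ring.
Qed.

(* The left-hand side is det (1 + J J^T), the squared volume of (1 | J). *)
Lemma cayley_identity (K : numFieldType) (v : nat -> K) :
  laplace 4 (gram_entry v) 0 (iota 0 4) =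
  Phi_test v ^+ 2 + \sum_(k < 7) (odd_test v k) ^+ 2
  + 4%:R^-1 * \sum_(k < 7) (even_test v k) ^+ 2.
Proof.
have sum7 (F : nat -> K) : \sum_(k < 7) F k =
    F 0%N + (F 1%N + (F 2%N + (F 3%N + (F 4%N + (F 5%N + F 6%N))))).
  by rewrite !big_ord_recl big_ord0 addr0.
rewrite (sum7 (fun k => odd_test v k ^+ 2)) (sum7 (fun k =>
  even_test v k ^+ 2)).
rewrite (@odd_test0 _ v 0 isT) (@odd_test0 _ v 1 isT) (@odd_test0 _ v 2 isT).
rewrite (@even_test0 _ v 3 isT) (@even_test0 _ v 4 isT).
rewrite (@even_test0 _ v 5 isT) (@even_test0 _ v 6 isT).
have [-> -> -> ->] := odd_testE v; have [-> -> ->] := even_testE v.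
have sq2 (x : K) : (2%:R * x) ^+ 2 = 4%:R * x ^+ 2 by ring.
rewrite expr0n !sq2 !add0r !addr0 -!mulrDr mulKf; last by rewrite pnatr_eq0.
(* Only the list is evaluated, so that the field operations stay visible to [ring]. *)
have -> : Phi_test v = ltac:(let x := eval vm_compute in Phi_terms in exact
  (foldr (fun t c => (if t.1.1 then - laplace 4 (graph_entry v) 0 t.2
                     else laplace 4 (graph_entry v) 0 t.2) + c) 0 x)) by [].
rewrite /cofactor_diff /minor3 /minor2 /gram_entry /graph_entry /=.
ring.
Qed.

(** * Real forms inside complex forms, and the curvature equations *)

Lemma cform_inj (R : realType) : injective (@cform R).
Proof.
by move=> a b /ffunP ab; apply/ffunP => A; have := ab A; rewrite !ffunE => -[].
Qed.

Lemma cform0 (R : realType) : cform (0 : form R) = 0.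
Proof. by apply/ffunP => A; rewrite !ffunE. Qed.

Lemma cform_wedge (R : realType) (a b : form R) :
  wedge (cform a) (cform b) = cform (wedge a b).
Proof.
apply/ffunP => A; rewrite !ffunE (rmorph_sum (real_complex R));
  apply: eq_bigr => B _.
by rewrite !ffunE !(rmorphM (real_complex R)) (rmorph_sign (real_complex R)).
Qed.

Lemma cform_wedge_exp (R : realType) (a : form R) (c : R[i]) n :
  wedge_exp (c *: cform a) n = c ^+ n *: cform (wedge_exp a n).
Proof.
rewrite /wedge_exp; elim: n => [|n IH] /=.
  by rewrite expr0 scale1r; apply/ffunP => A; rewrite !ffunE; case: eqP.
by rewrite IH wedgeZl wedgeZr cform_wedge scalerA exprS.
Qed.

Lemma cform_hodge (R : realType) (a : form R) :
  hodge (cform a) = cform (hodge a).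
Proof. by apply/ffunP => A;
  rewrite !ffunE (rmorphM (real_complex R)) (rmorph_sign (real_complex R)). Qed.

(** [orth_proj] is given by choice; its value at 0 is all that is required of it when the real or
    the imaginary part vanishes. *)
Lemma complexify_im (R : realType) (p : form R -> form R) (a : form R) :
  p 0 = 0 -> complexify p ('i%C *: cform a) = 'i%C *: cform (p a).
Proof.
move=> p0; rewrite /complexify.
have -> : [ffun A => complex.Re (('i%C *: cform a) A)] = 0.
  by apply/ffunP => A; rewrite !ffunE /=; ring.
have -> : [ffun A => complex.Im (('i%C *: cform a) A)] = a.
  by apply/ffunP => A; rewrite !ffunE /=; ring.
by rewrite p0 cform0 add0r.
Qed.

Lemma complexify_re (R : realType) (p : form R -> form R) (a : form R) :
  p 0 = 0 -> complexify p (cform a) = cform (p a).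
Proof.
move=> p0; rewrite /complexify.
have -> : [ffun A => complex.Re (cform a A)] = a by apply/ffunP => A;
  rewrite !ffunE.
have -> : [ffun A => complex.Im (cform a A)] = 0 by apply/ffunP => A;
  rewrite !ffunE.
by rewrite p0 cform0 scaler0 addr0.
Qed.

Lemma inner0l (R : realType) (a : form R) : inner 0 a = 0.
Proof. by rewrite /inner big1 // => A _; rewrite ffunE mul0r. Qed.

Lemma form_eval_Phi (R : realType) (v : nat -> R) :
  form_eval (Phi R) (\matrix_(i < 4, x < 8) graph_entry v i x) = Phi_test v.
Proof.
rewrite (Phi_ev v) /ev form_eval_sum.
pose L (t : term) := laplace 4 (graph_entry v) 0 t.2.
transitivity (\sum_(t <- Phi_terms) if t.1.1 then - L t else L t);
  last by rewrite unlock.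
have wfP : all (fun t : term =>
  [&& t.1.2 == [::], sorted ltn t.2, all (gtn 8) t.2
    & size t.2 == 4]) Phi_terms by vm_compute.
rewrite big_seq [RHS]big_seq; apply: eq_bigr => t /(allP wfP).
case/and4P => /eqP tm ss s8 /eqP sn.
by rewrite (form_eval_basis _ ss s8 sn) [t.1]surjective_pairing tm coefE
  big_nil mulr1 mulr_sign.
Qed.

Lemma gram_det (R : realType) (v : nat -> R) :
  let W := \matrix_(i < 4, x < 8) graph_entry v i x in
  \det (W *m W^T) = laplace 4 (gram_entry v) 0 (iota 0 4).
Proof.
move=> W; rewrite -det_laplace //; congr (\det _).
apply/matrixP => i k; rewrite !mxE nth_iota // !add0n.
under eq_bigr => x _ do rewrite !mxE.
rewrite -(big_mkord xpredT (fun x => graph_entry v i x * graph_entry v k x)).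
rewrite unlock /= /graph_entry /gram_entry /=.
by case: i => -[|[|[|[|//]]]] ? /=; case: k => -[|[|[|[|//]]]] ? /=; ring.
Qed.

Lemma imaginary_cform_eq0 (R : realType) (a : form R) :
  'i%C *: cform a = 0 <-> a = 0.
Proof.
split=> [|->]; last by rewrite cform0 scaler0.
move=> /ffunP ia; apply/ffunP => A; have := ia A.
by rewrite !ffunE /GRing.scale /= => -[_]; rewrite mul0r add0r mul1r.
Qed.

Lemma pi27_imaginary (R : realType) (a : form R) :
  let F := 'i%C *: cform a in
  pi27 (F + 6%:R^-1 *: hodge (wedge_exp F 3)) = 0 <->
  forall k : 'I_7, inner a (ev (fun _ => 0) (b27 k))
    = 6%:R^-1 * inner (hodge (wedge_exp a 3)) (ev (fun _ => 0) (b27 k)).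
Proof.
(* [b27] contains no variables, so any valuation serves. *)
move=> F; pose v (_ : nat) : R := 0.
have p27 : orth_proj (@Lambda27 R) 0 = 0.
  by apply/(orth_proj27_eq0 v) => k; rewrite inner0l.
have i3 : 'i%C ^+ 3 = - 'i%C :> R[i] by rewrite exprS sqr_i mulrN1.
rewrite /F cform_wedge_exp hodgeZ cform_hodge i3; move: (hodge _) => b.
have -> : 'i%C *: cform a + 6%:R^-1 *: (- 'i%C *: cform b) =
    'i%C *: cform (a - 6%:R^-1 *: b).
  apply/ffunP => A; rewrite !ffunE /GRing.scale /= (rmorphB (real_complex R)).
  rewrite (rmorphM (real_complex R)) (fmorphV (real_complex R)) rmorph_nat.
  by ring.
rewrite /pi27 complexify_im // imaginary_cform_eq0 (orth_proj27_eq0 v).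
split=> H k; have := H k; rewrite innerBl innerZl => /eqP.
  by rewrite subr_eq0 => /eqP.
by rewrite -subr_eq0 => /eqP.
Qed.

Lemma pi47_imaginary (R : realType) (a : form R) :
  let F := 'i%C *: cform a in
  pi47 (wedge_exp F 2) = 0 <->
  forall k : 'I_7, inner (wedge_exp a 2) (ev (fun _ => 0) (b47 k)) = 0.
Proof.
move=> F; pose v (_ : nat) : R := 0.
have p47 : orth_proj (@Lambda47 R) 0 = 0.
  by apply/(orth_proj47_eq0 v) => k; rewrite inner0l.
rewrite /F cform_wedge_exp sqr_i; move: (wedge_exp a 2) => b.
have -> : -1 *: cform b = cform (- b).
  by apply/ffunP => A; rewrite !ffunE /GRing.scale /= mulN1r rmorphN.
rewrite /pi47 complexify_re // -(cform0 R).
transitivity (orth_proj (@Lambda47 R) (- b) = 0);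
  first by split=> [/cform_inj|->].
rewrite (orth_proj47_eq0 v).
split=> H k; have := H k; rewrite -scaleN1r innerZl mulN1r => /eqP.
  by rewrite oppr_eq0 => /eqP.
by rewrite -oppr_eq0 => /eqP.
Qed.

Lemma pi27_curvature (R : realType) (v : nat -> R) :
  let F := 'i%C *: cform (ev v curvature_terms) in
  pi27 (F + 6%:R^-1 *: hodge (wedge_exp F 3)) = 0 <->
  forall k : 'I_7, odd_test v k = 0.
Proof.
move=> F; rewrite /F pi27_imaginary wedge_exp_curvature; last by [].
have wfc : wf curvature_terms by vm_compute.
have wfp : wf (curvature_power 3) by vm_compute.
have wf3 : wf (thodge (curvature_power 3)) by vm_compute.
have wf27 (k : 'I_7) : wf (b27 k).
  have : all (fun k => wf (b27 k)) (iota 0 7) by vm_compute.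
  by move=> /allP; apply; rewrite mem_iota /=.
rewrite (ev_thodge _ wfp).
have E (k : 'I_7) : odd_test v k =
  inner (ev v curvature_terms) (ev (fun _ => 0) (b27 k))
    - 6%:R^-1 * inner (ev v (thodge (curvature_power 3))) (ev (fun _ =>
      0) (b27 k)).
  rewrite (b27_constant (fun _ => 0) v (ltn_ord k)).
  by rewrite (inner_ev v wfc (wf27 k)) (inner_ev v wf3 (wf27 k)).
split=> H k; first by rewrite E H subrr.
by apply/eqP; rewrite -subr_eq0 -E H.
Qed.

Lemma pi47_curvature (R : realType) (v : nat -> R) :
  let F := 'i%C *: cform (ev v curvature_terms) in
  pi47 (wedge_exp F 2) = 0 <-> forall k : 'I_7, even_test v k = 0.
Proof.
move=> F; rewrite /F pi47_imaginary wedge_exp_curvature; last by [].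
have wf2 : wf (curvature_power 2) by vm_compute.
have wf47 (k : 'I_7) : wf (b47 k).
  have : all (fun k => wf (b47 k)) (iota 0 7) by vm_compute.
  by move=> /allP; apply; rewrite mem_iota /=.
have E (k : 'I_7) : even_test v k =
  inner (ev v (curvature_power 2)) (ev (fun _ => 0) (b47 k)).
  by rewrite (b47_constant (fun _ => 0) v) (inner_ev v wf2 (wf47 k)).
by split=> H k; have := H k; rewrite E.
Qed.

Lemma calibrated_iff_curvature (R : realType) (v : nat -> R) :
  let W := \matrix_(i < 4, x < 8) graph_entry v i x in
  let F := 'i%C *: cform (ev v curvature_terms) in
  form_eval (Phi R) W ^+ 2 = \det (W *m W^T) <->
  pi27 (F + 6%:R^-1 *: hodge (wedge_exp F 3)) = 0 /\ pi47 (wedge_exp F 2) = 0.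
Proof.
move=> W F.
rewrite form_eval_Phi gram_det cayley_identity.
have [odd1 odd2] := pi27_curvature v; have [even1 even2] := pi47_curvature v.
have sq_ge0 (G : nat -> R) : 0 <= \sum_(k < 7) G k ^+ 2.
  by apply: sumr_ge0 => k _; exact: sqr_ge0.
have sq_eq0 (G : nat -> R) : \sum_(k < 7) G k ^+ 2 = 0 ->
  forall k : 'I_7, G k = 0.
  move=> /eqP; rewrite psumr_eq0; last by move=> k _; exact: sqr_ge0.
  by move=> /allP G0 k; have := G0 k;
    rewrite mem_index_enum sqrf_eq0 => /(_ isT)/eqP.
have sum0 (G : nat -> R) : (forall k : 'I_7, G k = 0) ->
  \sum_(k < 7) G k ^+ 2 = 0.
  by move=> G0; rewrite big1 // => k _; rewrite G0 expr0n.
move: (sq_ge0 (odd_test v)) (sq_ge0 (even_test v)).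
split=> [H|[/odd1/sum0 -> /even1/sum0 ->]]; last by ring.
split; [apply: odd2; apply: sq_eq0; lra|apply: even2; apply: sq_eq0; lra].
Qed.

(** * Maps of class C^k *)

Section Ck.
Variable R : realType.

Lemma near_eq_differentiable (V W : normedModType R) (f g : V -> W) (a : V) :
  (\near a, f a = g a) -> differentiable f a -> differentiable g a.
Proof.
move=> fg fa.
have ga : g \o shift a = cst (g a) + 'd f a +o_ 0 id.
  apply/eqaddoP => e e0.
  have /eqaddoP/(_ _ e0) := diff_locally fa.
  have : \forall h \near (0 : V), f (h + a) = g (h + a).
    have := fg; rewrite (near_shift 0 a) => fg0.
    by apply: filterS fg0 => h; rewrite /= subr0.
  move=> fgn H; near=> h.
  have <- : ((f \o shift a) - (cst (f a) + 'd f a)) h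
      = ((g \o shift a) - (cst (g a) + 'd f a)) h.
    by rewrite !fctE /= (nbhs_singleton fg) (near fgn h).
  by near: h.
have dfc : continuous ('d f a) by exact: diff_continuous.
have dg : 'd g a = 'd f a :> (V -> W) by apply: diff_unique.
by apply/diff_locallyP; rewrite dg.
Unshelve. all: by end_near. Qed.

(** Openness turns equality on [U] into equality near each point, which derivatives can see. The
    inductions below rely on this because their formulas for ['D_v] hold only on [U]. *)
Lemma Ck_ext (V W : normedModType R) (k : nat) (U : set V) (f g : V -> W) :
  open U -> (forall x, U x -> f x = g x) -> Ck k U f -> Ck k U g.
Proof.
move=> oU; elim: k f g => [|k IH] f g fg /=.
  move=> cf x Ux; have fgx : \near x, f x = g x.
    by near=> y; apply: fg; near: y; exact: open_nbhs_nbhs.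
  rewrite /prop_for /continuous_at -(fg _ Ux); apply: cvg_trans (cf _ Ux).
  exact: near_eq_cvg.
have fgx x : U x -> \near x, f x = g x.
  by move=> Ux; near=> y; apply: fg; near: y; exact: open_nbhs_nbhs.
move=> [df cf]; split=> [x Ux|v].
  exact: near_eq_differentiable (fgx _ Ux) (df _ Ux).
by apply: IH (cf v) => x Ux; exact: near_eq_derive (fgx _ Ux).
Unshelve. all: by end_near. Qed.

Lemma Ck_subset (V W : normedModType R) (k : nat) (U U' : set V) (f : V -> W) :
  U' `<=` U -> Ck k U f -> Ck k U' f.
Proof.
move=> UU'; elim: k f => [|k IH] f /=; first by move=> cf x /UU'; exact: cf.
by move=> [df cf]; split=> [x /UU'|v]; [exact: df|exact: IH].
Qed.

Lemma Ck_cst (V W : normedModType R) (k : nat) (U : set V) (b : W) :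
  Ck k U (cst b : V -> W).
Proof.
elim: k b => [|k IH] b /=; first by move=> x _; exact: cst_continuous.
split=> [x _|v]; first exact: differentiable_cst.
by rewrite (_ : (fun x => _) = cst 0) //; apply/funext => x; rewrite derive_cst.
Qed.

Lemma Ck_affine (V W : normedModType R) (k : nat) (U : set V)
    (L : {linear V -> W}) (b : W) :
  continuous L -> Ck k U (fun x => L x + b).
Proof.
move=> cL.
have dL x : differentiable (fun x => L x + b) x.
  by apply: differentiableD;
    [exact: linear_differentiable|exact: differentiable_cst].
case: k => [|k] /=.
  by move=> x _; apply: differentiable_continuous.
split=> [x _|v]; first exact: dL.
rewrite (_ : (fun x => _) = cst (L v)); first exact: Ck_cst.
apply/funext => x; rewrite deriveE // diffD;
  [|exact: linear_differentiable|exact: differentiable_cst].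
by rewrite diff_lin // diff_cst /= addr0.
Qed.

Lemma CkD (V W : normedModType R) (k : nat) (U : set V) (f g : V -> W) :
  open U -> Ck k U f -> Ck k U g -> Ck k U (fun x => f x + g x).
Proof.
move=> oU; elim: k f g => [|k IH] f g /=.
  by move=> cf cg x Ux; apply: cvgD; [exact: cf|exact: cg].
move=> [df cf] [dg cg]; split=> [x Ux|v].
  by apply: differentiableD; [exact: df|exact: dg].
apply: Ck_ext (IH _ _ (cf v) (cg v)) => // x Ux.
by rewrite deriveD //; apply: diff_derivable; [exact: df|exact: dg].
Qed.

Lemma Ck_linear_comp (V W Z : normedModType R) (k : nat) (U : set V)
    (f : V -> W) (L : {linear W -> Z}) :
  open U -> continuous L -> Ck k U f -> Ck k U (fun x => L (f x)).
Proof.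
move=> oU cL; elim: k f => [|k IH] f /=.
  by move=> cf x Ux; apply: continuous_comp; [exact: cf|exact: cL].
move=> [df cf]; split=> [x Ux|v].
  by apply: differentiable_comp; [exact: df|exact: linear_differentiable].
apply: Ck_ext (IH _ (cf v)) => // x Ux.
have dfx := df _ Ux; rewrite !deriveE //;
  last exact/differentiable_comp/linear_differentiable.
have dLfx : differentiable L (f x) by exact: linear_differentiable.
have := congr1 (fun h : V -> Z => h v) (diff_comp dfx dLfx).
by rewrite /= diff_lin // => <-.
Qed.

(** The inner map being affine, the derivative along [v] of the composite is the composite with the
    derivative along the constant direction [L v]: the shape is preserved and induction on [k]
    applies. *)
Lemma Ck_comp_affine (V W Z : normedModType R) (k : nat) (U : set W)
    (f : W -> Z) (L : {linear V -> W}) (b : W) :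
  open U -> continuous L -> Ck k U f ->
  Ck k [set x | U (L x + b)] (fun x => f (L x + b)).
Proof.
move=> oU cL.
have dA x : differentiable (fun x => L x + b) x.
  by apply: differentiableD;
    [exact: linear_differentiable|exact: differentiable_cst].
have cA : continuous (fun x => L x + b) by move=> x;
  apply: differentiable_continuous.
have oA : open [set x | U (L x + b)] by move/continuousP : cA; exact.
elim: k f => [|k IH] f /=.
  by move=> cf x Ux; apply: (continuous_comp (cA x)); exact: cf.
move=> [df cf]; split=> [x Ux|v].
  by apply: (differentiable_comp (dA x)); exact: df.
apply: Ck_ext (IH _ (cf (L v))) => // x Ux /=.
have dfx := df _ Ux; rewrite !deriveE //;
  last exact: (differentiable_comp (dA x)).
have := congr1 (fun h : V -> Z => h v) (diff_comp (dA x) dfx).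
rewrite /= => ->; rewrite diffD;
  [|exact: linear_differentiable|exact: differentiable_cst].
by rewrite diff_lin // diff_cst /= addr0.
Qed.

(** The shape of the defining function in [level_set], where [L] is the fibre projection and [P] the
    base projection. *)
Lemma diff_affine_sub (V W Z : normedModType R) (L : {linear V -> Z}) (c : Z)
    (g : W -> Z) (P : {linear V -> W}) (x v : V) :
  continuous L -> continuous P -> differentiable g (P x) ->
  'd (fun y => L y + c + (- 1) *: g (P y)) x v = L v - 'd g (P x) (P v).
Proof.
move=> cL cP dg.
have dL : differentiable L x by exact: linear_differentiable.
have dP : differentiable P x by exact: linear_differentiable.
have dgP : differentiable (g \o P) x by exact: differentiable_comp.
have dc : differentiable (cst c : V -> Z) x by exact: differentiable_cst.
rewrite (_ : (fun y => _) = ((L : V -> Z) + cst c) - (g \o P)); last first.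
  by apply/funext => y; rewrite scaleN1r.
rewrite (diffB (differentiableD dL dc) dgP) (diffD dL dc) (diff_comp dP dg).
by rewrite diff_cst (diff_lin _ cL) (diff_lin _ cP) /= addr0.
Qed.

(** Velocity of a line lifted to the graph of [g], where [P] and [Q] are the inclusions of base and
    fibre in R^8. *)
Lemma derive_affine_graph (V W Y Z : normedModType R) (L : {linear V -> W})
  (b : W)
    (P : {linear W -> Z}) (Q : {linear Y -> Z}) (g : W -> Y) (x v : V) :
  continuous L -> continuous P -> continuous Q -> differentiable g (L x + b) ->
  'D_v (fun t => P (L t + b) + Q (g (L t + b))) x =
    P (L v) + Q ('d g (L x + b) (L v)).
Proof.
move=> cL cP cQ dg.
pose A : V -> W := (L : V -> W) + cst b.
have dL : differentiable L x by exact: linear_differentiable.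
have db : differentiable (cst b : V -> W) x by exact: differentiable_cst.
have dA : differentiable A x by exact: differentiableD.
have dP : differentiable P (A x) by exact: linear_differentiable.
have dQ : differentiable Q (g (A x)) by exact: linear_differentiable.
have dgA : differentiable (g \o A) x by exact: (differentiable_comp dA dg).
have dPA : differentiable (P \o A) x by exact: (differentiable_comp dA dP).
have dQgA : differentiable (Q \o (g \o A)) x
  by exact: (differentiable_comp dgA dQ).
have dAE w : 'd A x w = L w.
  by rewrite (diffD dL db) (diff_lin _ cL) diff_cst /= addr0.
have EP : 'd (P \o A) x v = P (L v)
  by rewrite (diff_comp dA dP) /= dAE (diff_lin _ cP).
have EQ : 'd (Q \o (g \o A)) x v = Q ('d g (L x + b) (L v)).
  by rewrite (diff_comp dgA dQ) (diff_comp dA dg) /= dAE (diff_lin _ cQ).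
have := deriveE v (differentiableD dPA dQgA).
by rewrite (diffD dPA dQgA) /= EP EQ.
Qed.

Lemma derive_linear_comp (V W Y Z : normedModType R) (P : {linear V -> W})
    (Q : {linear Y -> Z}) (g : W -> Y) (x v : V) :
  continuous P -> continuous Q -> differentiable g (P x) ->
  'D_v (fun t => Q (g (P t))) x = Q ('d g (P x) (P v)).
Proof.
move=> cP cQ dg.
have dP : differentiable P x by exact: linear_differentiable.
have dQ : differentiable Q (g (P x)) by exact: linear_differentiable.
have dgP : differentiable (g \o P) x by exact: (differentiable_comp dP dg).
have dQgP : differentiable (Q \o (g \o P)) x
  by exact: (differentiable_comp dgP dQ).
have := deriveE v dQgP.
by rewrite (diff_comp dgP dQ) (diff_comp dP dg) /= (diff_lin _ cP) (diff_lin _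
  cQ).
Qed.

Lemma smooth_continuous (V W : normedModType R) (U : set V) (f : V -> W) x :
  smooth_on U f -> U x -> {for x, continuous f}.
Proof. by move=> sf; apply: (sf 0%N). Qed.

Lemma smooth_differentiable (V W : normedModType R) (U : set V) (f : V -> W) x :
  smooth_on U f -> U x -> differentiable f x.
Proof. by move=> sf; apply: (sf 1%N).1. Qed.

End Ck.

(** * The graph as a submanifold *)

Lemma linear_rV_continuous (R : realType) (n : nat) (W : normedModType R)
  (L : {linear 'rV[R]_n -> W}) : continuous L.
Proof.
move=> x; apply: differentiable_continuous.
rewrite (_ : L = (\sum_(j < n) (fun v : 'rV[R]_n =>
  v 0 j *: L (delta_mx 0 j))) :> (_ -> _)).
  apply: differentiable_sum => j; apply: differentiableZl.
  exact: differentiable_coord.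
apply/funext => v; rewrite fct_sumE {1}(row_sum_delta v) linear_sum.
by apply: eq_bigr => j _; rewrite linearZ.
Qed.

Arguments linear_rV_continuous {R n W} L.

Definition base_linear (R : realType) : {linear 'rV[R]_8 -> 'rV[R]_4} :=
  (@lsubmx R 1 4 4 : {linear 'rV[R]_(4 + 4) -> 'rV[R]_4}).

Definition fibre_linear (R : realType) : {linear 'rV[R]_8 -> 'rV[R]_4} :=
  (@rsubmx R 1 4 4 : {linear 'rV[R]_(4 + 4) -> 'rV[R]_4}).

Lemma continuous_base (R : realType) : continuous (@base R).
Proof. exact: (linear_rV_continuous (base_linear R)). Qed.

Lemma torus_piP (R : realType) (y z : 'rV[R]_4) :
  torus_pi y = torus_pi z <-> exists k : 'rV[int]_4, z - y =
    (2 * pi) *: map_mx intr k.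
Proof.
rewrite /torus_pi; split=> [/eqmodP/asboolP //|yz].
by apply/eqmodP/asboolP.
Qed.

Lemma mx_norm_entry (R : realType) (m n : nat) (A : 'M[R]_(m, n)) i j :
  `|A i j| <= `|A|.
Proof.
rewrite [leRHS]/Num.norm /= mx_normrE.
exact: (le_bigmax _ (fun ij => `|A ij.1 ij.2|) (i, j)).
Qed.

(** A nonzero lattice vector has an entry that is 2 pi times a nonzero integer, so its sup norm is
    at least 2 pi. *)
Lemma torus_pi_inj_near (R : realType) (y z : 'rV[R]_4) :
  torus_pi y = torus_pi z -> `|z - y| < 2 * pi -> y = z.
Proof.
move=> /torus_piP[k yz] small; apply/esym/eqP; rewrite -subr_eq0 yz.
have pi2 : 0 < 2 * pi :> R by rewrite mulr_gt0 // pi_gt0.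
suff -> : k = 0 by rewrite map_mx0 scaler0.
apply/rowP => j; rewrite mxE; apply/eqP; apply: contraTT small => kj.
rewrite -leNgt yz; apply: le_trans (mx_norm_entry _ 0 j).
rewrite !mxE normrM (gtr0_norm pi2) ler_peMr ?(ltW pi2) //.
by rewrite -intr_norm ler1z -gtz0_ge1 normr_gt0.
Qed.

Definition graph_mx (R : realType) (J : 'M[R]_4) : 'M[R]_(4, 8) :=
  row_mx (1%:M : 'M[R]_4) J.

(** The constant [c] = [g (base q) - fibre q] is a lattice vector, so h = fibre + c - g o base
    vanishes at [q], and over [U] and [B] it takes lattice values exactly on the graph. Restricting
    to |h| < 2 pi leaves 0 as the only such value. *)
Lemma level_set (R : realType) (B : set 'rV[R]_4) (f : 'rV[R]_4 -> torus R)
    (U : set 'rV[R]_4) (g : 'rV[R]_4 -> 'rV[R]_4) (q : 'rV[R]_8) :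
  open B -> open U -> U (base q) -> smooth_on U g ->
  (forall z, U z -> torus_pi (g z) = f z) -> torus_graph B f (covering q) ->
  exists (V : set 'rV[R]_8) (h : 'rV[R]_8 -> 'rV[R]_4),
    [/\ open V, V q, smooth_on V h &
        forall q', V q' ->
          [/\ U (base q'), B (base q'),
              torus_graph B f (covering q') <-> h q' = 0 &
              forall v, 'd h q' v = fibre v - base v *m jacobian g (base q')]].
Proof.
move=> oB oU Uq sg gf [x Bx [xq fq]].
have pi2 : 0 < 2 * pi :> R by rewrite mulr_gt0 // pi_gt0.
pose c := g (base q) - fibre q.
pose h q' := (fibre q' + c) + (- 1) *: g (base q').
pose V1 := [set q' : 'rV[R]_8 | (U `&` B) (base q')].
have oV1 : open V1.
  by have /continuousP := @continuous_base R; apply; exact: openI.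
have sh : smooth_on V1 h.
  move=> k; apply: CkD => //;
    first exact: (Ck_affine k V1 c (linear_rV_continuous (fibre_linear R))).
  have cb := linear_rV_continuous (base_linear R).
  apply: (@Ck_linear_comp _ _ _ _ _ _ (fun q' =>
    g (base q')) (GRing.scale (-1))) => //.
    exact: linear_rV_continuous.
  have H := Ck_comp_affine 0 oU cb (sg k).
  by apply: (Ck_ext oV1 _ (Ck_subset _ H)) => q' [Uq' _]; rewrite /= addr0.
have hq : h q = 0.
  by rewrite /h /c scaleN1r [fibre q + _]addrC subrK subrr.
have V1q : V1 q by rewrite /V1 /= -xq; split => //; rewrite xq.
have : nbhs q (V1 `&` [set q' | `|h q'| < 2 * pi]).
  apply: filterI; first exact: open_nbhs_nbhs.
  have /cvgrPdist_lt/(_ _ pi2) : h @ q --> h q := smooth_continuous sh V1q.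
  by apply: filterS => q' /=; rewrite hq sub0r normrN.
rewrite nbhsE => -[V [oV Vq] VV1].
have hE q' : h q' = fibre q' + c - g (base q') by rewrite /h scaleN1r.
exists V, h; split=> //; first by move=> k;
  apply: Ck_subset (sh k) => q' /VV1[].
move=> q' /VV1[[Uq' Bq'] hq']; split=> // [|v].
  have cP : torus_pi (fibre q' + c) = torus_pi (fibre q').
    have /torus_piP[k ck] : torus_pi (fibre q) = torus_pi (g (base q)).
      by rewrite -fq xq gf.
    by apply/esym/torus_piP; exists k; rewrite addrAC subrr add0r.
  split=> [[x' Bx' [x'q' fq']]|h0].
    rewrite hE; apply/eqP; rewrite subr_eq0; apply/eqP/esym.
    by apply: torus_pi_inj_near; rewrite ?gf // ?cP -?x'q' // x'q' -hE.
  exists (base q') => //; congr (_, _).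
  by rewrite -cP -gf //; congr torus_pi; apply/esym/eqP;
    rewrite -subr_eq0 -hE h0.
have dg : differentiable g (base q') by exact: smooth_differentiable sg _.
have := diff_affine_sub c v (linear_rV_continuous (fibre_linear R))
  (linear_rV_continuous (base_linear R)) dg.
by rewrite -/(base q') /jacobian mul_rV_lin1.
Qed.

Lemma mul_graph_mx (R : realType) (m : nat) (w : 'M[R]_(m, 4)) (J : 'M[R]_4) :
  w *m graph_mx J = row_mx w (w *m J).
Proof. by have := mul_mx_row w 1%:M J; rewrite mulmx1. Qed.

Lemma base_row_mx (R : realType) (u w : 'rV[R]_4) : base (row_mx u w) = u.
Proof. exact: row_mxKl. Qed.

Lemma fibre_row_mx (R : realType) (u w : 'rV[R]_4) : fibre (row_mx u w) = w.
Proof. exact: row_mxKr. Qed.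

Lemma base_fibreK (R : realType) (v : 'rV[R]_8) : row_mx (base v) (fibre v) = v.
Proof. exact: hsubmxK. Qed.

Lemma submx_graph_mx (R : realType) (J : 'M[R]_4) (v : 'rV[R]_8) :
  (v <= graph_mx J)%MS <-> fibre v = base v *m J.
Proof.
split=> [/submxP[w ->]|vJ].
  by rewrite mul_graph_mx fibre_row_mx base_row_mx.
by apply/submxP; exists (base v); rewrite mul_graph_mx -vJ base_fibreK.
Qed.

Lemma graph_mx_free (R : realType) (J : 'M[R]_4) : row_free (graph_mx J).
Proof.
apply/row_freeP; exists (col_mx 1%:M 0 : 'M[R]_(4 + 4, 4)).
by have := mul_row_col 1%:M J 1%:M 0; rewrite mulmx0 mulmx1 addr0.
Qed.

Lemma submanifold4_torus_graph (R : realType) (B : set 'rV[R]_4)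
    (f : 'rV[R]_4 -> torus R) :
  open B -> smooth_to_torus B f -> submanifold4 (torus_graph B f).
Proof.
move=> oB sf q Sq.
have Bq : B (base q) by case: Sq => x Bx [<-].
have [g [U [oU Uq sg gf]]] := sf _ Bq.
have [V [h [oV Vq sh hV]]] := level_set oB oU Uq sg gf Sq.
exists V, h; split=> // q' /hV[Uq' Bq' SE dh] //.
apply/eqP; rewrite eqn_leq rank_leq_col /=.
(* On vertical vectors the differential of [h] is the identity, which forces rank 4. *)
pose Z : 'M[R]_(4, 8) := row_mx (0 : 'M[R]_4) (1%:M : 'M[R]_4).
have H : Z *m jacobian h q' = 1%:M.
  apply/row_matrixP => i; rewrite row_mul /jacobian mul_rV_lin1.
  have -> : row i Z = row_mx (0 : 'rV[R]_4) (row i 1%:M).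
    by have := row_row_mx i (0 : 'M[R]_4) 1%:M; rewrite row0.
  by rewrite dh fibre_row_mx base_row_mx mul0mx subr0.
by have := mxrankM_maxr Z (jacobian h q'); rewrite H mxrank1.
Qed.

(** Along a curve in the graph the defining function of [level_set] vanishes; differentiating puts
    the velocity in the kernel of its differential. Conversely, [v] is the velocity of the line
    through [x] in direction [base v], lifted to the graph by [g]. *)
Lemma tangent_torus_graph (R : realType) (B : set 'rV[R]_4)
    (f : 'rV[R]_4 -> torus R) (U : set 'rV[R]_4) (g : 'rV[R]_4 -> 'rV[R]_4)
    (x : 'rV[R]_4) :
  open B -> open U -> B x -> U x -> smooth_on U g ->
  (forall z, U z -> torus_pi (g z) = f z) ->
  forall v, tangent (torus_graph B f) (x, f x) v <->
            (v <= graph_mx (jacobian g x))%MS.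
Proof.
move=> oB oU Bx Ux sg gf v; rewrite submx_graph_mx; split.
  move=> [I [c [oI I0 sc [c0 Sc <-]]]].
  have bc0 : base (c 0) = x by case: c0.
  have Sc0 : torus_graph B f (covering (c 0)) by apply: Sc.
  have Uc0 : U (base (c 0)) by rewrite bc0.
  have [V [h [oV Vq sh hV]]] := level_set oB oU Uc0 sg gf Sc0.
  have [_ _ _ dh] := hV _ Vq.
  have dc : differentiable c 0 by exact: smooth_differentiable sc _.
  have dh0 : differentiable h (c 0) by exact: smooth_differentiable sh _.
  have hc0 : \forall t \near (0 : R^o), (cst 0 : R^o ->
    'rV[R]_4) t = (h \o c) t.
    have ccont : {for 0, continuous c} by exact: smooth_continuous sc _.
    have Vc : \forall t \near (0 : R^o), V (c t).
      by apply: ccont; exact: open_nbhs_nbhs.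
    have It : \forall t \near (0 : R^o), I t by exact: open_nbhs_nbhs.
    by apply: filterS2 Vc It => t /hV[_ _ SE _] /Sc/SE hct; rewrite /= hct.
  have := near_eq_derive (1 : R^o) hc0; rewrite derive_cst.
  rewrite deriveE; last exact: differentiable_comp.
  rewrite (diff_comp dc dh0) /= -(deriveE _ dc) dh bc0.
  by move=> /esym/eqP; rewrite subr_eq0 => /eqP.
move=> vJ; set u := base v in vJ.
have line_linear : linear (fun t : R^o => t *: u).
  by move=> a s t; rewrite scalerDl scalerA.
have [line cline line1] : exists2 L : {linear R^o ->
  'rV[R]_4}, continuous L & L 1 = u.
  pose L : {linear R^o -> 'rV[R]_4} :=
    HB.pack (fun t : R^o => t *: u) (GRing.isLinear.Build _ _ _ _ _
      line_linear).
  by exists L; [exact: scalel_continuous|exact: scale1r].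
have line0 : line 0 + x = x by rewrite linear0 add0r.
pose P : {linear 'rV[R]_4 -> 'rV[R]_8} :=
  mulmxr (row_mx (1%:M : 'M[R]_4) (0 : 'M[R]_4) : 'M[R]_(4, 8)).
pose Q : {linear 'rV[R]_4 -> 'rV[R]_8} :=
  mulmxr (row_mx (0 : 'M[R]_4) (1%:M : 'M[R]_4) : 'M[R]_(4, 8)).
have PE w : P w = row_mx w (0 : 'rV[R]_4).
  by have := mul_mx_row w (1%:M : 'M[R]_4) (0 : 'M[R]_4); rewrite mulmx1 mulmx0.
have QE w : Q w = row_mx (0 : 'rV[R]_4) w.
  by have := mul_mx_row w (0 : 'M[R]_4) (1%:M : 'M[R]_4); rewrite mulmx1 mulmx0.
have PQ w w' : P w + Q w' = row_mx w w'.
  by rewrite PE QE; have := add_row_mx w (0 : 'rV[R]_4) 0 w';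
    rewrite addr0 add0r.
have cP : continuous P by exact: linear_rV_continuous.
have cQ : continuous Q by exact: linear_rV_continuous.
pose I := [set t : R^o | (U `&` B) (line t + x)].
have oUB : open (U `&` B) by exact: openI.
have cA : continuous (fun t => line t + x).
  by move=> t; apply: cvgD; [exact: cline|exact: cvg_cst].
have oI : open I by move/continuousP : cA; exact.
exists I, (fun t => P (line t + x) + Q (g (line t + x))); split=> //.
- by rewrite /I /mkset line0.
- move=> k; apply: CkD => //.
    by apply: (Ck_linear_comp (f := fun t => line t + x)) => //;
      exact: Ck_affine.
  apply: (Ck_linear_comp (f := fun t => g (line t + x))) => //.
  exact: (Ck_comp_affine x oUB cline (Ck_subset (@subIsetl _ U B) (sg k))).
split.
- by rewrite line0 PQ /covering base_row_mx fibre_row_mx gf.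
- move=> t [Ut Bt]; rewrite PQ /covering base_row_mx fibre_row_mx gf //.
  by exists (line t + x).
have dg0 : differentiable g (line 0 + x).
  by rewrite line0; exact: smooth_differentiable sg Ux.
rewrite (derive_affine_graph _ cline cP cQ dg0) line0 line1 PQ.
rewrite -[RHS]base_fibreK vJ.
by rewrite /jacobian mul_rV_lin1.
Qed.

(** * The curvature of the transform in terms of the Jacobian *)

Definition jac_entry (R : realType) (J : 'M[R]_4) (n : nat) : R :=
  J (inord (n %/ 4)) (inord (n %% 4)).

Lemma jac_entryE (R : realType) (J : 'M[R]_4) (i a : 'I_4) :
  jac_entry J (4 * i + a) = J i a.
Proof.
rewrite /jac_entry mulnC divnMDl // modnMDl divn_small // modn_small // addn0.
by rewrite !inord_val.
Qed.

Lemma graph_mxE (R : realType) (J : 'M[R]_4) :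
  graph_mx J = \matrix_(i < 4, x < 8) graph_entry (jac_entry J) i x.
Proof.
apply/matrixP => i x; rewrite [RHS]mxE /graph_mx /graph_entry.
case: (@split_ordP 4 4 x) => k ->.
  by rewrite (row_mxEl 1%:M J) mxE -val_eqE /=; case: eqP.
by rewrite (row_mxEr 1%:M J) addKn jac_entryE.
Qed.

(** At fixed [A] the coefficient of the potential is a linear function of [g (base q')], so the
    chain rule replaces [g] by its differential. *)
Lemma derive_FM_potential (R : realType) (g : 'rV[R]_4 -> 'rV[R]_4)
    (q v : 'rV[R]_8) (A : {set 'I_8}) :
  differentiable g (base q) ->
  'D_v (fun q' => FM_potential g q' A : R^o) q =
  (\sum_(a < 4) (base v *m jacobian g (base q)) 0 a *: covec R (rshift 4 a)) A.
Proof.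
move=> dg.
pose F (y : 'rV[R]_4) : R^o := (\sum_(a < 4) y 0 a *: covec R (rshift 4 a)) A.
have F_linear : linear F.
  move=> c y z; rewrite /F !sum_ffunE scaler_sumr -big_split /=.
  by apply: eq_bigr => a _; rewrite !ffunE !mxE /GRing.scale /=; ring.
pose Q : {linear 'rV[R]_4 -> R^o} :=
  HB.pack F (GRing.isLinear.Build _ _ _ _ _ F_linear).
have := derive_linear_comp v (linear_rV_continuous (base_linear R))
  (linear_rV_continuous Q) dg.
by rewrite /jacobian mul_rV_lin1.
Qed.

Lemma covec_basis (K : numFieldType) (i : 'I_8) :
  covec K i = basis_form K (idx [:: val i]).
Proof.
apply/ffunP => A; rewrite !ffunE; congr (_ == _)%:R.
by apply/setP => k; rewrite !inE.
Qed.

Lemma curvature_ext_d (R : realType) (g : 'rV[R]_4 -> 'rV[R]_4) (q : 'rV[R]_8) :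
  differentiable g (base q) ->
  ext_d (FM_potential g) q = ev (jac_entry (jacobian g (base q)))
    curvature_terms.
Proof.
move=> dg; set J := jacobian g (base q).
have Di (i : 'I_8) : [ffun A => 'D_(delta_mx 0 i) (fun q' =>
  FM_potential g q' A : R^o) q]
    = \sum_(a < 4) (base (delta_mx 0 i) *m J) 0 a *: covec R (rshift 4 a).
  by apply/ffunP => A; rewrite ffunE derive_FM_potential.
rewrite /ext_d; under eq_bigr => i _ do rewrite Di wedge_sumr.
(* The potential depends on the base coordinates only, so its last four partial derivatives
   vanish. *)
rewrite (@big_split_ord _ _ _ 4 4) /= [X in _ + X]big1 ?addr0; last first.
  move=> i _; rewrite big1 // => a _.
  have -> : base (delta_mx 0 (rshift 4 i)) = 0 :> 'rV[R]_4.
    by apply/rowP => j; rewrite !mxE eq_lrshift andbF.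
  by rewrite mul0mx mxE scale0r wedge0r.
rewrite /ev /curvature_terms big_allpairs_dep.
rewrite -[iota 0 4]/(index_iota 0 4) big_mkord; apply: eq_bigr => i _.
rewrite big_mkord; apply: eq_bigr => a _.
have -> : base (delta_mx 0 (lshift 4 i)) = delta_mx 0 i :> 'rV[R]_4.
  by apply/rowP => j; rewrite !mxE (inj_eq (@lshift_inj _ _)).
rewrite -rowE mxE wedgeZr !covec_basis wedge_basis_idx; last 2 first.
- by rewrite /multi_index /= andbT; exact: ltn_ord (lshift 4 i).
- by rewrite /multi_index /= andbT; exact: ltn_ord (rshift 4 a).
have i4 := ltn_ord i.
have -> : has (mem [:: val (lshift 4 i)]) [:: val (rshift 4 a)] = false.
  by rewrite /= inE orbF; apply/negbTE/eqP; lia.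
have -> : inversions [:: val (lshift 4 i)] [:: val (rshift 4 a)] = 0%N.
  by rewrite /inversions /=; lia.
by rewrite scale1r /coef /= mulr1 jac_entryE.
Qed.

(** * Orthonormal frames and orientations *)

Lemma form_eval_mul (R : realType) (k : nat) (a : form R) (C : 'M[R]_k)
  (E : 'M[R]_(k, 8)) :
  form_eval a (C *m E) = \det C * form_eval a E.
Proof.
rewrite /form_eval mulr_sumr; apply: eq_bigr => A _.
rewrite mulrCA -det_mulmx; congr (_ * \det _).
by apply/matrixP => i j; rewrite !mxE; apply: eq_bigr => l _; rewrite mxE.
Qed.

(** Induction by Schur complement, as in the Cholesky decomposition. Positivity of the determinant
    means that orthonormalizing a basis this way keeps its orientation. *)
Lemma gram_orthonormal (R : realType) (n : nat) (G : 'M[R]_n) :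
  G^T = G -> (forall v : 'rV[R]_n, v != 0 -> 0 < (v *m G *m v^T) 0 0) ->
  exists2 A : 'M[R]_n, 0 < \det A & A *m G *m A^T = 1%:M.
Proof.
elim: n G => [|n IH] G.
  by exists 1%:M; [rewrite det1 ltr01|apply/matrixP => -[]].
move: G; rewrite -[n.+1]/(1 + n)%N => G symG posG.
have GE : G = block_mx (ulsubmx G) (ursubmx G) (ursubmx G)^T (drsubmx G).
  rewrite -[LHS]submxK; congr (block_mx _ _ _ _).
  by rewrite trmx_ursub symG.
set b := ursubmx G in GE; set D := drsubmx G in GE.
move: GE; rewrite [ulsubmx _]mx11_scalar; set a := (X in X%:M) => GE.
have symD : D^T = D by rewrite trmx_drsub symG.
have a_gt0 : 0 < a.
  have e0 : row_mx 1%:M 0 != 0 :> 'rV[R]_(1 + n).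
    apply/eqP => /(congr1 (@lsubmx R 1 1 n)); rewrite row_mxKl linear0.
    by move=> /matrixP/(_ 0 0)/eqP; rewrite !mxE oner_eq0.
  have := posG _ e0; rewrite GE mul_row_block tr_row_mx mul_row_col.
  by rewrite !mul1mx !mul0mx !addr0 trmx0 mulmx0 addr0 trmx1 mulmx1 mxE eqxx.
have a0 := lt0r_neq0 a_gt0.
pose S := D - a^-1 *: (b^T *m b).
have symS : S^T = S.
  by rewrite /S linearB linearZ /= trmx_mul trmxK symD.
have posS (w : 'rV[R]_n) : w != 0 -> 0 < (w *m S *m w^T) 0 0.
  (* [v] completes [w] to a vector that is [G]-orthogonal to the initial basis vector, so [G] at [v]
     equals the Schur complement at [w]. *)
  move=> w0; pose v : 'rV[R]_(1 + n) := row_mx (- a^-1 *: (w *m b^T)) w.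
  have v0 : v != 0.
    apply: contra w0 => /eqP/(congr1 (@rsubmx R 1 1 n)).
    by rewrite row_mxKr linear0 => /eqP.
  have -> : w *m S *m w^T = v *m G *m v^T; last exact: posG.
  rewrite GE /v mul_row_block tr_row_mx mul_row_col.
  have -> : - a^-1 *: (w *m b^T) *m a%:M + w *m b^T = 0.
    by rewrite mul_mx_scalar scalerA mulrN mulfV // scaleN1r addNr.
  rewrite mul0mx add0r; congr (_ *m _).
  by rewrite /S mulmxBr addrC -scalemxAl -scalemxAr mulmxA scaleNr.
have [A' detA' A'S] := IH S symS posS.
pose r := Num.sqrt a.
have r0 : r != 0 by rewrite gt_eqF // sqrtr_gt0.
have rr : r * r = a by rewrite -expr2 sqr_sqrtr // ltW.
pose A : 'M[R]_(1 + n) := block_mx (r^-1)%:M 0 (- a^-1 *: (A' *m b^T)) A'.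
exists A; first by rewrite det_lblock det_scalar1 mulr_gt0 //
  invr_gt0 sqrtr_gt0.
rewrite GE /A mulmx_block tr_block_mx mulmx_block.
have -> : - a^-1 *: (A' *m b^T) *m a%:M + A' *m b^T = 0.
  by rewrite mul_mx_scalar scalerA mulrN mulfV // scaleN1r addNr.
have -> : - a^-1 *: (A' *m b^T) *m b + A' *m D = A' *m S.
  by rewrite /S mulmxBr addrC -scalemxAl -scalemxAr mulmxA scaleNr.
rewrite !mul0mx trmx0 !mulmx0 !addr0 !add0r A'S tr_scalar_mx -!scalar_mxM.
have -> : r^-1 * a * r^-1 = 1 by rewrite -rr mulrA mulVf // mul1r mulfV.
rewrite linearZ /= trmx_mul trmxK !mul_scalar_mx -scalemxAl scalerA -scalerDl.
have -> : r^-1 * a * - a^-1 + r^-1 = 0.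
  by rewrite mulrN -mulrA mulfV // mulr1 addNr.
by rewrite scale0r [RHS]scalar_mx_block.
Qed.

Lemma mx_continuous (R : realType) (T : topologicalType) (m n : nat)
    (F : T -> 'M[R]_(m.+1, n.+1)) (x : T) :
  (forall i j, {for x, continuous (fun t => F t i j)}) -> {for x, continuous F}.
Proof.
move=> cF; rewrite /prop_for /continuous_at.
rewrite (_ : F = fun t => \sum_i \sum_j F t i j *: delta_mx i j); last first.
  by apply/funext => t; exact: matrix_sum_delta.
apply: cvg_big => [|i _]; first exact: add_continuous.
apply: cvg_big => [|j _]; first exact: add_continuous.
by apply: cvgZr_tmp; exact: cF.
Qed.

Lemma mulmx_continuous (R : realType) (T : topologicalType) (m n p : nat)
    (D : 'M[R]_(m, n)) (F : T -> 'M[R]_(n, p)) (x : T) i j :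
  (forall k l, {for x, continuous (fun t => F t k l)}) ->
  {for x, continuous (fun t => (D *m F t) i j)}.
Proof.
move=> cF; rewrite /prop_for /continuous_at mxE.
under eq_fun do rewrite mxE.
apply: cvg_big => [|k _]; first exact: add_continuous.
by apply: cvgM; [exact: cvg_cst|exact: cF].
Qed.

Lemma form_eval_continuous (R : realType) (T : topologicalType) (k : nat)
    (a : form R) (F : T -> 'M[R]_(k, 8)) (x : T) :
  (forall i j, {for x, continuous (fun t => F t i j)}) ->
  {for x, continuous (fun t => form_eval a (F t))}.
Proof.
move=> cF; rewrite /prop_for /continuous_at /form_eval.
apply: cvg_big => [|A _]; first exact: add_continuous.
apply: cvgM; first exact: cvg_cst.
rewrite /determinant.
apply: cvg_big => [|s _]; first exact: add_continuous.
apply: cvgM; first exact: cvg_cst.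
apply: cvg_big => [|i _]; first exact: mul_continuous.
under eq_fun do rewrite mxE.
by rewrite mxE; exact: cF.
Qed.

Lemma orthonormalize (R : realType) (E : 'M[R]_(4, 8)) : row_free E ->
  exists2 A : 'M[R]_4, 0 < \det A & orthonormal_frame (A *m E).
Proof.
move=> fE.
have [||A dA AE] := @gram_orthonormal R 4 (E *m E^T).
- by rewrite trmx_mul trmxK.
- move=> v v0; rewrite !mulmxA -mulmxA -trmx_mul; set w := v *m E.
  have w0 : w != 0.
    by apply: contra v0 => /eqP w0; rewrite -(mulmxKp fE v) -/w w0 mul0mx.
  have -> : (w *m w^T) 0 0 = \sum_j w 0 j ^+ 2.
    by rewrite mxE; apply: eq_bigr => j _; rewrite [w^T _ _]mxE.
  rewrite lt0r.
  rewrite sumr_ge0 ?andbT => [|j _]; last exact: sqr_ge0.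
  apply: contra w0 => /eqP; move=> /psumr_eq0P w0.
  apply/eqP/rowP => j; rewrite [RHS]mxE; apply/eqP.
  by rewrite -sqrf_eq0 w0 // => k _; exact: sqr_ge0.
by exists A => //; rewrite /orthonormal_frame trmx_mul !mulmxA -(mulmxA A).
Qed.

(** * Calibrated tangent spaces and Cayley orientations *)

Lemma tangent_basisP (R : realType) (B : set 'rV[R]_4)
    (f : 'rV[R]_4 -> torus R) (U : set 'rV[R]_4) (g : 'rV[R]_4 -> 'rV[R]_4)
    (x : 'rV[R]_4) (E : 'M[R]_(4, 8)) :
  open B -> open U -> B x -> U x -> smooth_on U g ->
  (forall z, U z -> torus_pi (g z) = f z) ->
  tangent_basis (torus_graph B f) (x, f x) E <->
  exists2 A : 'M[R]_4, \det A != 0 & E = A *m graph_mx (jacobian g x).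
Proof.
move=> oB oU Bx Ux sg gf.
have tg := tangent_torus_graph oB oU Bx Ux sg gf.
have fg := graph_mx_free (jacobian g x).
split=> [[fE tE]|[A dA ->]].
  have /submxP[A EA] : (E <= graph_mx (jacobian g x))%MS.
    by apply/row_subP => i; apply/tg/tE; exact: row_sub.
  exists A => //; rewrite -unitfE -unitmxE -row_free_unit.
  by move: fE; rewrite EA /row_free mxrankMfree.
have uA : A \in unitmx by rewrite unitmxE unitfE.
split; first by rewrite /row_free mxrankMfree // -/(row_free A) row_free_unit.
by move=> v; rewrite tg eqmxMfull // row_full_unit.
Qed.

(** Squaring removes the dependence on orientation; a change of basis multiplies both sides by the
    square of its determinant, so any basis of the tangent space can be used. *)
Definition calibrated_mx (R : realType) (J : 'M[R]_4) : Prop :=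
  form_eval (Phi R) (graph_mx J) ^+ 2 = \det (graph_mx J *m (graph_mx J)^T).

Lemma calibrated_mxP (R : realType) (J C : 'M[R]_4) :
  orthonormal_frame (C *m graph_mx J) ->
  calibrated_mx J <-> form_eval (Phi R) (C *m graph_mx J) ^+ 2 = 1.
Proof.
move=> orthC; have H : (\det C) ^+ 2 * \det (graph_mx J *m (graph_mx J)^T) = 1.
  have := congr1 determinant orthC;
    rewrite trmx_mul mulmxA -(mulmxA C) !det_mulmx.
  by rewrite det_tr det1 => <-; rewrite expr2 mulrAC.
rewrite /calibrated_mx form_eval_mul exprMn -H; split=> [->//|].
apply: mulfI; apply/eqP => C0; move: H; rewrite C0 mul0r => /eqP.
by rewrite eq_sym oner_eq0.
Qed.

Lemma lift_atP (R : realType) (B : set 'rV[R]_4) (f : 'rV[R]_4 -> torus R) x :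
  smooth_to_torus B f -> B x -> local_lift f x (lift_at f x).
Proof.
by move=> sf /sf[g gx]; rewrite /lift_at; apply: (xgetPex _ (ex_intro _ g gx)).
Qed.

Lemma FM_curvature_calibrated (R : realType) (B : set 'rV[R]_4)
    (f : 'rV[R]_4 -> torus R) (q : 'rV[R]_8) :
  smooth_to_torus B f -> B (base q) ->
  calibrated_mx (jacobian (lift_at f (base q)) (base q)) <->
  pi27 (FM_curvature f q + 6%:R^-1 *: hodge (wedge_exp (FM_curvature f q) 3)) =
    0 /\
  pi47 (wedge_exp (FM_curvature f q) 2) = 0.
Proof.
move=> sf Bq; have [U [oU Uq sg gf]] := lift_atP sf Bq.
have dg := smooth_differentiable sg Uq.
rewrite /FM_curvature (curvature_ext_d dg) /calibrated_mx graph_mxE.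
exact: calibrated_iff_curvature.
Qed.

Lemma calibrated_of_cayley (R : realType) (B : set 'rV[R]_4)
    (f : 'rV[R]_4 -> torus R) o x :
  open B -> smooth_to_torus B f -> cayley (torus_graph B f) o -> B x ->
  calibrated_mx (jacobian (lift_at f x) x).
Proof.
move=> oB sf [_ ori cal] Bx.
have [U [oU Ux sg gf]] := lift_atP sf Bx; set g := lift_at f x in sg gf *.
have Sp : torus_graph B f (x, f x) by exists x.
pose q : 'rV[R]_8 := row_mx x (g x).
have pq : covering q = (x, f x)
  by rewrite /covering base_row_mx fibre_row_mx gf.
have [|V [E [_ Vq _ /(_ q Vq)]]] := ori q; first by rewrite pq.
rewrite pq => /(_ Sp)[bE oE].
(* As [A] has positive determinant, the orthonormal frame still belongs to the given orientation. *)
have [A dA orthA] := orthonormalize bE.1.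
have [A0 dA0 EA0] := (tangent_basisP _ oB oU Bx Ux sg gf).1 bE.
move: orthA; rewrite EA0 mulmxA; set C := A *m A0 => orthC.
have oC : o (x, f x) (C *m graph_mx (jacobian g x)).
  by rewrite oE EA0; exists A => //; rewrite mulmxA.
have tW i : tangent (torus_graph B f) (x, f x) (row i (C *m graph_mx (jacobian
  g x))).
  apply/(tangent_torus_graph oB oU Bx Ux sg gf).
  by rewrite row_mul; exact: submxMl.
(* The calibration condition is evaluated on the frame itself, where the volume form is 1. *)
have := cal _ Sp _ oC orthC _ tW; rewrite orthC det1 => c1.
by apply/(calibrated_mxP orthC); rewrite c1 expr1n.
Qed.

Definition Phi_orientation (R : realType) (S : set (ambient R))
  (p : ambient R) :
    set 'M[R]_(4, 8) :=
  [set E | tangent_basis S p E /\ 0 < form_eval (Phi R) E].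

(** The tangent space of the graph does not depend on the lift, and (1 | J') = A (1 | J) forces A =
    1, so all lifts have the same Jacobian at [x]. *)
Lemma calibrated_lift (R : realType) (B U : set 'rV[R]_4)
    (f : 'rV[R]_4 -> torus R) (g : 'rV[R]_4 -> 'rV[R]_4) x :
  open B -> smooth_to_torus B f -> open U -> B x -> U x -> smooth_on U g ->
  (forall z, U z -> torus_pi (g z) = f z) ->
  calibrated_mx (jacobian (lift_at f x) x) -> calibrated_mx (jacobian g x).
Proof.
move=> oB sf oU Bx Ux sg gf.
have [U' [oU' Ux' sg' gf']] := lift_atP sf Bx.
suff -> : jacobian (lift_at f x) x = jacobian g x by [].
have /(tangent_basisP _ oB oU' Bx Ux' sg' gf')[A _ gA] :
    tangent_basis (torus_graph B f) (x, f x) (graph_mx (jacobian g x)).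
  apply/(tangent_basisP _ oB oU Bx Ux sg gf).
  by exists 1%:M; rewrite ?det1 ?oner_eq0 ?mul1mx.
move: gA; rewrite mul_graph_mx => /(@eq_row_mx _ 4 4 4 _ _ _ _)[<-].
by rewrite mul1mx => ->.
Qed.

(** On an orthonormal basis of the row space the value of [Phi] squares to 1. *)
Lemma calibrated_neq0 (R : realType) (J : 'M[R]_4) :
  calibrated_mx J -> form_eval (Phi R) (graph_mx J) != 0.
Proof.
move=> cJ; have [C _ orthC] := orthonormalize (graph_mx_free J).
have := (calibrated_mxP orthC).1 cJ; rewrite form_eval_mul => H.
by apply/eqP => f0; move: H; rewrite f0 mulr0 expr0n => /eqP;
  rewrite eq_sym oner_eq0.
Qed.

Lemma graph_jacobian_continuous (R : realType) (U : set 'rV[R]_4)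
    (g : 'rV[R]_4 -> 'rV[R]_4) (q : 'rV[R]_8) i j :
  open U -> smooth_on U g -> U (base q) ->
  {for q, continuous (fun q' => graph_mx (jacobian g (base q')) i j)}.
Proof.
move=> oU sg Uq; rewrite /prop_for /continuous_at.
case: (@split_ordP 4 4 j) => k ->.
  have -> : (fun q' => graph_mx (jacobian g (base q')) i (lshift 4 k)) =
      cst ((1%:M : 'M[R]_4) i k).
    by apply/funext => q'; exact: row_mxEl.
  have -> : graph_mx (jacobian g (base q)) i (lshift 4 k) =
    (1%:M : 'M[R]_4) i k.
    exact: row_mxEl.
  exact: (@cvg_cst R _ _ (nbhs q) _).
have E (J : 'M[R]_4) : graph_mx J i (rshift 4 k) = J i k by exact: row_mxEr.
have -> : (fun q' => graph_mx (jacobian g (base q')) i (rshift 4 k)) =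
    (fun q' => 'd g (base q') (delta_mx 0 i) 0 k).
  by apply/funext => q'; rewrite E mxE.
rewrite E mxE.
have cd : Ck 0 U (fun y => 'd g y (delta_mx 0 i)).
  have Dg : Ck 0 U ('D_(delta_mx 0 i) g) := (sg 1%N).2 _.
  apply: (Ck_ext oU _ Dg) => y Uy.
  by rewrite deriveE //; exact: smooth_differentiable sg Uy.
have cdb := continuous_comp (@continuous_base R q) (cd _ Uq).
exact: (continuous_comp cdb (@coord_continuous _ _ _ _ _ _)).
Qed.

Lemma orientation_torus_graph (R : realType) (B : set 'rV[R]_4)
    (f : 'rV[R]_4 -> torus R) :
  open B -> smooth_to_torus B f ->
  (forall x, B x -> calibrated_mx (jacobian (lift_at f x) x)) ->
  orientation (torus_graph B f) (Phi_orientation (torus_graph B f)).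
Proof.
move=> oB sf cal q Sq.
have Bq : B (base q) by case: Sq => x Bx [<-].
have [g [U [oU Uq sg gf]]] := sf _ Bq.
pose F q' := graph_mx (jacobian g (base q')).
pose c q' := form_eval (Phi R) (F q').
have c0 q' : U (base q') -> B (base q') -> c q' != 0.
  by move=> Uq' Bq'; apply/calibrated_neq0/(calibrated_lift oB sf oU Bq' Uq' sg
    gf)/cal.
have cc : {for q, continuous c}.
  by apply: form_eval_continuous => i j; exact: graph_jacobian_continuous Uq.
(* The sign is frozen at [q], which keeps the frame below continuous; [V] is chosen so that [c]
   retains this sign over the base points in [U] and [B]. *)
pose s := Num.sg (c q).
have oUB : open [set q' | (U `&` B) (@base R q')].
  by have /continuousP := @continuous_base R; apply; exact: openI.
have : nbhs q ([set q' | (U `&` B) (@base R q')] `&` [set q' | 0 < s * c q']).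
  apply: filterI; first exact: open_nbhs_nbhs.
  have sc : (fun q' => s * c q') @ q --> s * c q by apply: cvgM cc;
    exact: cvg_cst.
  have sc0 : 0 < s * c q by rewrite -normrEsg normr_gt0 c0.
  have := sc _ (open_nbhs_nbhs (conj (@open_gt R 0) sc0)).
  exact.
rewrite nbhsE => -[V [oV Vq] VP].
(* Multiplying one row by [s] makes [Phi] positive on the frame. *)
pose D : 'M[R]_4 := diag_mx (\row_j if j == 0 then s else 1).
have detD : \det D = s.
  by rewrite det_diag big_ord_recl mxE big1 ?mulr1 // => j _; rewrite mxE.
exists V, (fun q' => D *m F q'); split=> //.
  apply: continuous_in_subspaceT => q' /set_mem[/VP[[Uq' _] _] _].
  apply: mx_continuous => i j; apply: mulmx_continuous => k l.
  exact: graph_jacobian_continuous Uq'.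
move=> q' /VP[[Uq' Bq'] sc] Sq'.
have pq' : covering q' = (base q', f (base q')) by case: Sq' => x _ [xq' fq'];
  rewrite /covering -fq' xq'.
have s0 : s != 0 by rewrite sgr_eq0 c0.
have tb := tangent_basisP _ oB oU Bq' Uq' sg gf.
rewrite pq'; split; first by apply/tb; exists D; rewrite ?detD.
apply/seteqP; split=> E /=.
  rewrite /Phi_orientation /= => -[/tb[A dA ->]] fE.
  have uD : D \in unitmx by rewrite unitmxE detD unitfE.
  exists (A *m invmx D); last by rewrite mulmxA mulmxKV.
  rewrite det_mulmx det_inv detD.
  rewrite form_eval_mul -/(F q') -/(c q') in fE.
  (* The product is positive and equals [\det A / s] times a square, so the change of basis has
     positive determinant. *)
  have : 0 < \det A * c q' * (s * c q') by rewrite mulr_gt0.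
  have -> : \det A * c q' * (s * c q') = (\det A / s) * (s * c q') ^+ 2
    by field.
  by rewrite pmulr_lgt0 // exprn_gt0.
move=> [A dA <-]; split.
  apply/tb; exists (A *m D); last by rewrite mulmxA.
  by rewrite det_mulmx detD mulf_neq0 // gt_eqF.
by rewrite !form_eval_mul detD mulr_gt0.
Qed.

Lemma cayley_of_calibrated (R : realType) (B : set 'rV[R]_4)
    (f : 'rV[R]_4 -> torus R) :
  open B -> smooth_to_torus B f ->
  (forall x, B x -> calibrated_mx (jacobian (lift_at f x) x)) ->
  cayley (torus_graph B f) (Phi_orientation (torus_graph B f)).
Proof.
move=> oB sf cal; split; first exact: submanifold4_torus_graph.
  exact: orientation_torus_graph.
move=> _ [x Bx <-] E [bE fE] orthE W tW.
have [U [oU Ux sg gf]] := lift_atP sf Bx.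
have [A dA EA] := (tangent_basisP _ oB oU Bx Ux sg gf).1 bE.
have f1 : form_eval (Phi R) E = 1.
  have orthA := orthE; rewrite EA in orthA.
  have := (calibrated_mxP orthA).1 (cal _ Bx); rewrite -EA => /eqP.
  rewrite sqrf_eq1 => /orP[/eqP //|/eqP fN]; move: fE.
  by rewrite fN oppr_gt0 ltr10.
(* With W = C E, both sides equal the determinant of [C]. *)
have /submxP[C ->] : (W <= E)%MS by apply/row_subP => i; apply/bE.2.
by rewrite form_eval_mul f1 mulr1 -mulmxA orthE mulmx1.
Qed.

Theorem theorem1p1 (R : realType) (B : set 'rV[R]_4) (f : 'rV[R]_4 -> torus R)
    (hB : open B) (hf : smooth_to_torus B f) :
  (exists o : ambient R -> set 'M[R]_(4, 8), cayley (torus_graph B f) o) <->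
  (forall q : 'rV[R]_8, B (base q) ->
     pi27 (FM_curvature f q
           + 6%:R^-1 *: hodge (wedge_exp (FM_curvature f q) 3)) = 0 /\
     pi47 (wedge_exp (FM_curvature f q) 2) = 0).
Proof.
split=> [[orient cay] q Bq|H].
  apply/(FM_curvature_calibrated hf Bq).
  exact: calibrated_of_cayley hB hf cay Bq.
exists (Phi_orientation (torus_graph B f)).
apply: cayley_of_calibrated => // x Bx.
(* A point of R^8 over [x] is needed; the fibre coordinate 0 is an arbitrary choice. *)
have bx : base (row_mx x 0 : 'rV[R]_8) = x by exact: base_row_mx.
rewrite -bx in Bx *; apply/(FM_curvature_calibrated hf Bx); exact: H.
Qed.
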